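(* Let $G$ be a finitely presented group, let $\lambda:G\twoheadrightarrow\Gamma$ be a surjective homomorphism onto a finite group $\Gamma$, and let $\mathbb{K}$ be a field which is sufficiently large with respect to $\Gamma$. Let $K_\lambda=\ker\lambda$ and $q=\operatorname{char}\mathbb{K}$. Then $$b_1^{(q)}(K_\lambda)=b_1^{(q)}(G)+\sum_{\rho\neq\mathbf{1}}n_\rho\left(\operatorname{corank}J^{\rho\circ\lambda}-n_\rho\right),$$ where $\rho$ runs through all (isomorphism classes of) non-trivial irreducible $\mathbb{K}$-representations of $\Gamma$, $n_\rho$ is the dimension of $\rho$, and $J^{\rho\circ\lambda}$ is the Fox Jacobian matrix of $G$ followed by the representation $\rho\circ\lambda:G\to\mathrm{GL}(n_\rho,\mathbb{K})$.
   Context: A field $\mathbb{K}$ is sufficiently large with respect to a finite group $\Gamma$ if (i) $\operatorname{char}\mathbb{K}$ is $0$ or coprime to $|\Gamma|$, and (ii) $\mathbb{K}$ contains all $e$-th roots of unity, where $e$ is the exponent of $\Gamma$. Mod $q$ Betti numbers: $b_1^{(0)}(G)=b_1(G)=\dim_{\mathbb{Q}}H_1(G;\mathbb{Q})$, and for a prime $q$, $b_1^{(q)}(G)=\dim_{\mathbb{F}_q}H_1(G;\mathbb{F}_q)$. Fix a finite presentation $G=\langle x_1,\dots,x_\ell\mid r_1,\dots,r_m\rangle$, with presenting epimorphism $\phi:F_\ell\to G$ from the free group $F_\ell$ on $x_1,\dots,x_\ell$. With $\epsilon:\mathbb{Z}F_\ell\to\mathbb{Z}$ the augmentation, the Fox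 derivatives $\partial/\partial x_j:\mathbb{Z}F_\ell\to\mathbb{Z}F_\ell$ are the linear operators with $\frac{\partial 1}{\partial x_j}=0$, $\frac{\partial x_i}{\partial x_j}=\delta_{ij}$, $\frac{\partial(uv)}{\partial x_j}=\frac{\partial u}{\partial x_j}\epsilon(v)+u\frac{\partial v}{\partial x_j}$. The Fox Jacobian matrix is the $m\times\ell$ matrix $J=J_G=\left(\phi\left(\frac{\partial r_i}{\partial x_j}\right)\right)$ over $\mathbb{Z}G$. For a representation $\mu:G\to\mathrm{GL}(n,\mathbb{K})$, $J^\mu$ is the $mn\times\ell n$ matrix over $\mathbb{K}$ obtained by applying (the linear extension of) $\mu$ to each entry of $J$, and $\operatorname{corank}J^\mu=\ell n-\operatorname{rank}J^\mu$. *)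

(* Defs.v *)
From HB Require Import structures.
From mathcomp Require Import all_boot all_order all_algebra.
From mathcomp Require Import all_fingroup all_solvable all_character.
From mathcomp Require Import freeg.

Set Implicit Arguments.
Unset Strict Implicit.
Unset Printing Implicit Defensive.

Import GRing.Theory.
Local Open Scope ring_scope.

(* Free groups are made of reduced words in the letters (i, false) = x_i and *)
(* (i, true) = x_i^-1.                                                       *)
Section FreeGroup.
Variable l : nat.

Definition letter := ('I_l * bool)%type.
Definition linv (a : letter) : letter := (a.1, ~~ a.2).
Definition reduced_word (w : seq letter) := sorted (fun a b => b != linv a) w.

Record free_group := FreeGroup {
  word : seq letter;
  _ : reduced_word word }.

HB.instance Definition _ := [isSub for word].
HB.instance Definition _ := [Choice of free_group by <:].

Definition push (a : letter) (w : seq letter) :=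
  if w is b :: w' then if b == linv a then w' else a :: w else [:: a].

Definition reduce_word := foldr push [::].

Lemma linvK : involutive linv.
Proof. by case=> i b; rewrite /linv /= negbK. Qed.

Lemma push_reduced a w : reduced_word w -> reduced_word (push a w).
Proof.
case: w => [|b w] //= pw.
case: ifP => [_|nb]; first exact: path_sorted pw.
by rewrite /= nb.
Qed.

Lemma reduce_word_reduced w : reduced_word (reduce_word w).
Proof. by elim: w => //= a w IH; apply: push_reduced. Qed.

Lemma reduce_word_id w : reduced_word w -> reduce_word w = w.
Proof.
elim: w => //= a w IH pw; rewrite IH; last exact: path_sorted pw.
by case: w pw {IH} => //= b w /andP[/negPf ->].
Qed.

Lemma pushK a w : reduced_word w -> push a (push (linv a) w) = w.
Proof.
case: w => [|b w] /=; first by rewrite eqxx.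
rewrite linvK; case: (eqVneq b a) => [->|nba] pw /=; last by rewrite eqxx.
by case: w pw => //= c w /andP[/negPf ->].
Qed.

Lemma reduce_cat_push a v w :
  reduced_word v ->
  reduce_word (push a v ++ w) = push a (reduce_word (v ++ w)).
Proof.
case: v => [|b v] //= pv; case: eqP => [->|//] /=.
by rewrite pushK ?reduce_word_reduced.
Qed.

Lemma reduce_catl v w : reduce_word (reduce_word v ++ w) = reduce_word (v ++ w).
Proof.
by elim: v => //= a v IH; rewrite reduce_cat_push ?reduce_word_reduced ?IH.
Qed.

Lemma reduce_catr v w : reduce_word (v ++ reduce_word w) = reduce_word (v ++ w).
Proof.
elim: v => [|a v /= ->] //=.
by rewrite reduce_word_id ?reduce_word_reduced.
Qed.

Definition free_of (w : seq letter) := FreeGroup (reduce_word_reduced w).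

Lemma free_ofK (u : free_group) : free_of (word u) = u.
Proof. by apply/val_inj; case: u => w rw; rewrite /= reduce_word_id. Qed.

Definition free_gen (i : 'I_l) := free_of [:: (i, false)].

Definition free_one := free_of [::].
Definition free_mul (u v : free_group) := free_of (word u ++ word v).
Definition free_inv (u : free_group) := free_of (rev (map linv (word u))).

Lemma free_mulE v w : free_mul (free_of v) (free_of w) = free_of (v ++ w).
Proof. by apply/val_inj; rewrite /= reduce_catl reduce_catr. Qed.

Lemma free_mulA : associative free_mul.
Proof.
move=> u v w; rewrite -(free_ofK u) -(free_ofK v) -(free_ofK w).
by rewrite !free_mulE catA.
Qed.

Lemma free_mul1 : left_id free_one free_mul.
Proof. by move=> u; rewrite -(free_ofK u) free_mulE. Qed.

Lemma free_mulr1 : right_id free_one free_mul.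
Proof. by move=> u; rewrite -(free_ofK u) free_mulE cats0. Qed.

Lemma reduce_invl w : reduce_word (rev (map linv w) ++ w) = [::].
Proof.
elim: w => //= a w IH; rewrite rev_cons cat_rcons -reduce_catr /=.
by rewrite -{2}(linvK a) pushK ?reduce_word_reduced // reduce_catr.
Qed.

Lemma free_mulV : left_inverse free_one free_inv free_mul.
Proof.
move=> u; rewrite /free_mul /free_inv; apply/val_inj => /=.
by rewrite reduce_catl reduce_invl.
Qed.

Lemma free_mulrV : right_inverse free_one free_inv free_mul.
Proof.
move=> u; rewrite /free_mul /free_inv; apply/val_inj => /=.
rewrite reduce_catr.
rewrite -{1}(mapK linvK (word u)) -{1}[map linv (word u)]revK map_rev.
by rewrite reduce_invl.
Qed.

HB.instance Definition _ := isGroup.Build free_group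
  free_mulA free_mul1 free_mulr1 free_mulV free_mulrV.

End FreeGroup.

Inductive normal_closure (F : groupType) (R : F -> Prop) : F -> Prop :=
| nc_gen u : R u -> normal_closure R u
| nc_one : normal_closure R 1%g
| nc_mul u v :
    normal_closure R u -> normal_closure R v -> normal_closure R (u * v)%g
| nc_inv u : normal_closure R u -> normal_closure R (u^-1)%g
| nc_conj u v : normal_closure R u -> normal_closure R (u ^ v)%g.

(* phi presents G as < x_1, ..., x_l | r_1, ..., r_m >. *)
Definition presentation (G : groupType) (l m : nat)
    (r : 'I_m -> free_group l) (phi : UMagmaMorphism.type (free_group l) G) :=
  (forall g, exists u, phi u = g) /\
  (forall u, phi u = 1%g <-> normal_closure (fun v => exists i, v = r i) u).

Section ZLinear.
Variables (X : choiceType) (V : zmodType).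

(* [zmodule V] is V as a Z-module, so this is the Z-linear extension of f.  *)
Definition zlin (f : X -> V) (u : {freeg X / int}) : V :=
  fglift (f : X -> zmodule V) u.

Lemma zlinB f : {morph zlin f : u v / u - v}.
Proof. exact: (@lift_is_additive int X (zmodule V) f). Qed.

HB.instance Definition _ f :=
  GRing.isZmodMorphism.Build {freeg X / int} V (zlin f) (zlinB f).

Lemma zlin1 f x : zlin f << x >> = f x.
Proof. by rewrite /zlin liftU scale1r. Qed.

Lemma zlinU f k x : zlin f << k *g x >> = f x *~ k.
Proof. by rewrite /zlin liftU. Qed.

Lemma eq_zlin_gen (f g : {additive {freeg X / int} -> V}) :
  (forall x, f << x >> = g << x >>) -> f =1 g.
Proof.
move=> fg u; rewrite -[u]freeg_sumE !raddf_sum /=; apply: eq_bigr => x _.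
by rewrite -[coeff x u]intz -freegU_mulz !raddfMz fg.
Qed.

End ZLinear.

Definition group_ring_of (G : groupType) : Type := {freeg G / int}.
HB.instance Definition _ (G : groupType) :=
  GRing.Zmodule.copy (group_ring_of G) {freeg G / int}.

Section GroupRing.
Variable G : groupType.
Local Notation ZG := (group_ring_of G).

Definition gr (g : G) : ZG := << g >>.

Definition gr_mul (u v : ZG) : ZG :=
  zlin (fun g => zlin (fun h => gr (g * h)%g) v) u.

Definition gr_mulr (v u : ZG) := gr_mul u v.

Lemma gr_mulBl v : {morph gr_mulr v : u w / u - w}.
Proof. by move=> u w; rewrite /gr_mulr /gr_mul raddfB. Qed.

Lemma gr_mul_sum u v : gr_mul u v =
  \sum_(g <- dom u) zlin (fun h => gr (g * h)%g) v *~ coeff g u.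
Proof.
rewrite -[u in LHS]freeg_sumE /gr_mul raddf_sum.
by apply: eq_bigr => g _; exact: zlinU.
Qed.

Lemma gr_mulBr u : {morph gr_mul u : v w / v - w}.
Proof.
move=> v w; rewrite !gr_mul_sum -sumrB.
by apply: eq_bigr => g _; rewrite raddfB mulrzBl.
Qed.

HB.instance Definition _ v :=
  GRing.isZmodMorphism.Build ZG ZG (gr_mulr v) (gr_mulBl v).
HB.instance Definition _ u :=
  GRing.isZmodMorphism.Build ZG ZG (gr_mul u) (gr_mulBr u).

Lemma gr_mulE g h : gr_mul (gr g) (gr h) = gr (g * h)%g.
Proof. by rewrite /gr_mul !zlin1. Qed.

Lemma eq_additive_gr (V : zmodType) (f f' : {additive ZG -> V}) :
  (forall g, f (gr g) = f' (gr g)) -> f =1 f'.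
Proof. exact: eq_zlin_gen. Qed.

Lemma gr_mul1 : left_id (gr 1%g) gr_mul.
Proof.
by apply: (eq_additive_gr (f := gr_mul _) (f' := idfun)) => g;
   rewrite /= gr_mulE mul1g.
Qed.

Lemma gr_mulr1 : right_id (gr 1%g) gr_mul.
Proof.
by apply: (eq_additive_gr (f := gr_mulr _) (f' := idfun)) => g;
   rewrite /= /gr_mulr gr_mulE mulg1.
Qed.

Lemma gr_mulA : associative gr_mul.
Proof.
move=> u v w.
apply: (eq_additive_gr (f := gr_mulr (gr_mul v w))
  (f' := gr_mulr w \o gr_mulr v)) u => g /=.
apply: (eq_additive_gr (f := gr_mul (gr g) \o gr_mulr w)
  (f' := gr_mulr w \o gr_mul (gr g))) v => h /=.
apply: (eq_additive_gr (f := gr_mul (gr g) \o gr_mul (gr h))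
  (f' := gr_mul (gr_mul (gr g) (gr h)))) w => k /=.
by rewrite /gr_mulr !gr_mulE mulgA.
Qed.

Lemma gr_mulDl : left_distributive gr_mul +%R.
Proof. by move=> u v w; exact: (raddfD (gr_mulr w)). Qed.

Lemma gr_mulDr : right_distributive gr_mul +%R.
Proof. by move=> u v w; exact: raddfD. Qed.

Lemma gr1_neq0 : gr 1%g != 0.
Proof. by rewrite freegU_eq0. Qed.

HB.instance Definition _ := GRing.Zmodule_isNzRing.Build ZG
  gr_mulA gr_mul1 gr_mulr1 gr_mulDl gr_mulDr gr1_neq0.

Lemma grM g h : gr (g * h)%g = gr g * gr h.
Proof. by rewrite -gr_mulE. Qed.

Lemma gr1 : gr 1%g = 1.
Proof. by []. Qed.

Lemma gr_ind (P : ZG -> Prop) : (forall g, P (gr g)) ->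
  (forall u v, P u -> P v -> P (u - v)) -> forall u, P u.
Proof.
move=> Pg PB u; have P0 : P 0 by rewrite -(subrr (gr 1%g)); apply: PB.
have PN v : P v -> P (- v) by move=> Pv; rewrite -sub0r; apply: PB.
have PD v w : P v -> P w -> P (v + w).
  by move=> Pv Pw; rewrite -[w]opprK; apply: PB => //; apply: PN.
rewrite -[u]freeg_sumE; elim/big_ind: _ => // g _.
rewrite -[coeff g u]intz -freegU_mulz; elim/int_ind: (coeff g u) => [|n IH|n IH].
- by rewrite mulr0z.
- by rewrite intS mulrzDr; apply: PD => //; apply: Pg.
- by rewrite -addn1 PoszD opprD mulrzDr; apply: PD => //; apply: PN; apply: Pg.
Qed.

Definition augmentation (u : ZG) : int := zlin (fun _ => 1) u.

HB.instance Definition _ := GRing.isZmodMorphism.Build ZG int augmentation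
  (zlinB (fun _ : G => 1 : int)).

End GroupRing.

Definition gr_map (G H : groupType) (f : G -> H) (u : group_ring_of G) :
  group_ring_of H := zlin (fun g => gr (f g)) u.

Section Fox.
Variable l : nat.
Local Notation F := (free_group l).
Local Notation ZF := (group_ring_of (free_group l)).
Implicit Types (i j : 'I_l) (a : letter l) (w : seq (letter l)).

Definition fox_letter j a : ZF :=
  (a.1 == j)%:R * (if a.2 then - gr (free_gen a.1)^-1%g else 1).

Fixpoint fox_word j w : ZF :=
  if w is a :: w' then fox_letter j a + gr (free_of [:: a]) * fox_word j w'
  else 0.

(* The lemmas fox1, fox_gen and foxM below are the rules which, together with *)
(* additivity, characterize the Fox derivatives.                              *)
Definition fox j (u : ZF) : ZF := zlin (fun v : F => fox_word j (word v)) u.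

Lemma free_ofM v w : free_of (v ++ w) = (free_of v * free_of w)%g.
Proof. by symmetry; apply: free_mulE. Qed.

Lemma free_of_linv a : free_of [:: linv a] = ((free_of [:: a])^-1)%g.
Proof. by apply/val_inj. Qed.

Lemma fox_word_cat j v w :
  fox_word j (v ++ w) = fox_word j v + gr (free_of v) * fox_word j w.
Proof.
elim: v => [|a v /= ->].
  by rewrite /= add0r (_ : gr (free_of [::]) = 1) // mul1r.
by rewrite -[a :: v]cat1s free_ofM grM mulrDr addrA mulrA.
Qed.

Lemma fox_word_linv j a : fox_word j [:: a; linv a] = 0.
Proof.
rewrite /= mulr0 addr0 /fox_letter /=; case: (a.1 == j); last first.
  by rewrite !mul0r mulr0 addr0.
rewrite !mul1r; case: a => i [] /=.
  have -> : free_of [:: (i, true)] = ((free_gen i)^-1)%g by apply/val_inj.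
  by rewrite mulr1 addNr.
by rewrite mulrN -grM mulgV addrN.
Qed.

Lemma fox_word_push j a w : fox_word j (push a w) = fox_word j (a :: w).
Proof.
case: w => [|b w] //; rewrite /push; case: eqP => [->|//].
rewrite -[a :: _]/([:: a; linv a] ++ w) fox_word_cat fox_word_linv add0r.
by rewrite -cat1s free_ofM free_of_linv mulgV gr1 mul1r.
Qed.

Lemma fox_word_reduce j w : fox_word j (reduce_word w) = fox_word j w.
Proof. by elim: w => //= a w IH; rewrite fox_word_push /= IH. Qed.

HB.instance Definition _ j := GRing.isZmodMorphism.Build ZF ZF (fox j)
  (zlinB (fun v : F => fox_word j (word v))).

Lemma fox1 j : fox j 1 = 0.
Proof. exact: zlin1. Qed.

Lemma fox_gen j i : fox j (gr (free_gen i)) = (i == j)%:R.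
Proof. by rewrite /fox zlin1 /= mulr0 addr0 /fox_letter /= mulr1. Qed.

Lemma foxM j u v :
  fox j (u * v) = fox j u * (augmentation v)%:~R + u * fox j v.
Proof.
elim/gr_ind: u => [g|u1 u2 IH1 IH2]; last first.
  by rewrite !mulrBl !raddfB /= IH1 IH2 mulrBl opprD addrACA.
elim/gr_ind: v => [h|v1 v2 IH1 IH2]; last first.
  by rewrite !mulrBr !raddfB /= IH1 IH2 !mulrBr opprD addrACA.
rewrite -grM /fox /augmentation !zlin1 mulr1.
by rewrite [word _]/= fox_word_reduce fox_word_cat free_ofK.
Qed.

End Fox.

Definition fox_jacobian (G : groupType) (l m : nat)
    (r : 'I_m -> free_group l) (phi : free_group l -> G) :
  'M[group_ring_of G]_(m, l) :=
  \matrix_(i, j) gr_map phi (fox j (gr (r i))).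

(* J^mu for the linear extension of mu : G -> GL(n, K): the entry (i, j) of  *)
(* J becomes an n x n block, so that J^mu is an mn x ln matrix.              *)
Definition specialize (G : groupType) (K : fieldType) (n m l : nat)
    (mu : G -> 'M[K]_n) (J : 'M[group_ring_of G]_(m, l)) :
  'M[K]_(\sum_(i < m) n, \sum_(j < l) n) :=
  \mxblock_(i < m, j < l) zlin mu (J i j).

Definition corank (G : groupType) (K : fieldType) (n m l : nat)
    (mu : G -> 'M[K]_n) (J : 'M[group_ring_of G]_(m, l)) : nat :=
  (l * n - \rank (specialize mu J))%N.

Section Homology.
Variables (F : fieldType) (C2 C1 C0 : lmodType F).
Variables (d2 : {linear C2 -> C1}) (d1 : {linear C1 -> C0}).

(* ker d1 / im d2 has a basis made of the classes of n cycles z_i. *)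
Definition homology_dim (n : nat) : Prop :=
  exists2 z : 'I_n -> C1, forall i, d1 (z i) = 0 &
    forall c, d1 c = 0 ->
      exists! a : 'rV[F]_n, exists b, c = \sum_i a 0 i *: z i + d2 b.

Lemma homology_dim_le n p : homology_dim n -> homology_dim p -> (n <= p)%N.
Proof.
case=> z z0 zP [y y0 yP].
have coord k (x : 'I_k -> C1) (x0 : forall i, d1 (x i) = 0) q
    (t : 'I_q -> C1) : (forall c, d1 c = 0 ->
      exists! a : 'rV[F]_q, exists b, c = \sum_i a 0 i *: t i + d2 b) ->
    exists A : 'M[F]_(k, q), exists b : 'I_k -> C2,
      forall i, x i = \sum_j A i j *: t j + d2 (b i).
  move=> tP; have E i : exists ab : 'rV[F]_q * C2,
      x i == \sum_j ab.1 0 j *: t j + d2 ab.2.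
    by have [a [[b ->] _]] := tP _ (x0 i); exists (a, b).
  exists (\matrix_i (xchoose (E i)).1), (fun i => (xchoose (E i)).2) => i.
  rewrite {1}(eqP (xchooseP (E i))); congr (_ + _).
  by apply: eq_bigr => j _; rewrite mxE.
have [A [b zE]] := coord _ z z0 _ _ yP.
have [B [c yE]] := coord _ y y0 _ _ zP.
suff AB : A *m B = 1%:M.
  by rewrite -(mxrank1 F n) -AB (leq_trans (mxrankM_maxr _ _)) ?rank_leq_row.
apply/row_matrixP => i; have [a [_ aU]] := zP _ (z0 i).
transitivity a; [symmetry|]; apply: aU; last first.
  exists 0; rewrite raddf0 addr0 (bigD1 i) //= !mxE eqxx scale1r big1 ?addr0 //.
  by move=> j ji; rewrite !mxE eq_sym (negPf ji) scale0r.
exists (\sum_j A i j *: c j + b i).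
rewrite raddfD raddf_sum /= addrA [LHS]zE; congr (_ + _).
transitivity (\sum_j (\sum_k A i j *: (B j k *: z k) + A i j *: d2 (c j))).
  by apply: eq_bigr => j _; rewrite -scaler_sumr -scalerDr -yE.
rewrite big_split exchange_big /=; congr (_ + _).
  apply: eq_bigr => k _; rewrite !mxE scaler_suml.
  by apply: eq_bigr => j _; rewrite scalerA.
by apply: eq_bigr => j _; rewrite linearZ.
Qed.

Lemma homology_dim_inj n p : homology_dim n -> homology_dim p -> n = p.
Proof.
by move=> hn hp; apply/eqP; rewrite eqn_leq !homology_dim_le.
Qed.

End Homology.

Section LinearLift.
Variables (F : fieldType) (X : choiceType) (V : lmodType F) (f : X -> V).

Lemma fglift_is_linear : linear (fglift f).
Proof.
pose h : {additive {freeg X / F} -> V} := HB.pack (fglift f)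
  (GRing.isZmodMorphism.Build _ _ (fglift f) (@lift_is_additive F X V f)).
have hZ c D : h (c *: D) = c *: h D.
  rewrite -[D in RHS]freeg_sumE [in RHS](raddf_sum h) scaler_sumr.
  rewrite [c *: D]/(fgscale c D) /fgscale (raddf_sum h).
  by apply: eq_bigr => x _; rewrite /h /= !liftU scalerA.
by move=> c u v; rewrite -[LHS]/(h (c *: u + v)) raddfD hZ.
Qed.

End LinearLift.

Section GroupHomology.
Variables (F : fieldType) (G : groupType).

(* The bar complex of G with trivial coefficients F in degrees 2, 1 and 0: *)
(* d2 [g|h] = [h] - [gh] + [g] and d1 [g] = [] - [].                       *)
Definition bar2 : {freeg (G * G)%type / F} -> {freeg G / F} :=
  fglift (fun gh => << gh.2 >> - << (gh.1 * gh.2)%g >> + << gh.1 >>).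
Definition bar1 : {freeg G / F} -> {freeg unit / F} :=
  fglift (fun=> << tt >> - << tt >>).

HB.instance Definition _ :=
  GRing.isLinear.Build F _ _ _ bar2 (fglift_is_linear _).
HB.instance Definition _ :=
  GRing.isLinear.Build F _ _ _ bar1 (fglift_is_linear _).

Definition H1_dim (n : nat) : Prop := homology_dim bar2 bar1 n.

End GroupHomology.

(* Used for q = 0 or q prime; 'F_q has q elements only in the latter case. *)
Definition prime_field (q : nat) : fieldType :=
  if q is 0 then rat : fieldType else 'F_q.

(* The first mod q Betti number of G is (well defined and) equal to b. *)
Definition betti1 (q : nat) (G : groupType) (b : nat) : Prop :=
  H1_dim (prime_field q) G b.

Section Kernel.
Variables (G H : groupType) (f : UMagmaMorphism.type G H).

Definition in_kernel : pred G := fun g => f g == 1%g.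

Record kernel := Kernel { kernel_val : G; _ : in_kernel kernel_val }.

HB.instance Definition _ := [isSub for kernel_val].
HB.instance Definition _ := [Choice of kernel by <:].

Lemma in_kernel_closed : group_closed in_kernel.
Proof.
split=> [|x y]; rewrite !unfold_in /in_kernel ?gmulf1 //.
by move=> /eqP fx /eqP fy; rewrite gmulfF fx fy divg1.
Qed.

HB.instance Definition _ :=
  SubChoice_isSubGroup.Build G in_kernel kernel in_kernel_closed.

End Kernel.

Definition has_char (K : fieldType) (q : nat) : Prop :=
  if q is 0 then [pchar K] =i pred0 else q \in [pchar K].

Definition sufficiently_large (K : fieldType) (gT : finGroupType) : Prop :=
  (forall q, has_char K q -> q = 0%N \/ coprime q #|[set: gT]|) /\
  (exists s : seq K,
     'X^(exponent [set: gT]) - 1 = \prod_(z <- s) ('X - z%:P)).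

(* Main.v *)
Require Import Defs.
From HB Require Import structures.
From mathcomp Require Import all_boot all_order all_algebra.
From mathcomp Require Import all_fingroup all_solvable all_field all_character.
From mathcomp Require Import freeg.
From mathcomp Require Import boolp.

(** Why the theorem holds.  Write Gamma for the finite group and N for the
    kernel of the epimorphism lambda onto it.

    A derivation of G with values in a G-module M is determined by its values
    on the generators x_j, and by the product rule of the Fox derivatives a
    family of values comes from a derivation exactly when it is killed by the
    Jacobian matrix.  Hence corank J^M is the dimension of the space of
    1-cocycles of G in M ([cocycle_row_ker], [ker_cocycle_row]).

    Take for M the functions on a set Y on which G acts transitively and let H
    be the stabilizer of a point.  Shapiro's lemma, in the explicit form given
    by the Schreier elements t_y g (t_(yg))^-1, says that modulo coboundaries
    the cocycles are the homomorphisms from H to the field; the coboundaries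
    form a space of dimension #|Y| - 1.  So b_1(H) + #|Y| = corank + 1
    ([stab_H1_dim]).  With Y = Gamma this computes b_1 of N, and with Y a point
    it computes b_1 of G.  Both Jacobians have entries in the prime field, so
    their coranks may be computed over K.

    It remains to decompose the regular representation of Gamma over K.  The
    rank of the Jacobian is additive over direct sums of modules
    ([sub_rank_sum]); if every irreducible representation is absolutely
    irreducible then rho occurs n_rho times in the regular representation, and
    the sum of the squares n_rho^2 is the order of Gamma, which gives
    [corank_regular] and then the formula.

    The last hypothesis is Brauer's theorem that a field containing the
    roots of unity of order the exponent of Gamma is a splitting field
    ([sufficient_roots_splitting]).

    - In characteristic p the representations over a finite subfield that
      contains the roots of unity are considered first.  There the endomorphism
      ring D of an irreducible representation is commutative by Wedderburn,
      hence contained in the enveloping algebra by the density theorem.  An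
      element a of D is thus a combination of group elements; raising it to
      the power Q, the order of the field, fixes the coefficients and the
      group elements, up to commutators, so a^Q = a and a is a scalar
      ([finite_field_splitting]).  Splitting persists in the larger field
      ([pchar_splitting]).

    - In characteristic 0 one argues by induction on the group.  If it has a
      cyclic normal subgroup with nilpotent quotient, Clifford theory for a
      noncentral abelian normal subgroup reduces to a proper subgroup
      ([cyclic_by_nilpotent_splitting]).  Otherwise the constant 1 lies in the
      ideal spanned by the permutation characters on the cosets of proper
      subgroups, by the argument of Solomon and Banaschewski.  Since D acts on
      an irreducible V, on restriction to a proper subgroup, which is split,
      all multiplicities in V are divisible by d = dim D, so the inner product
      of the character of V with itself is divisible by d^2 there.  Writing 1
      as a combination of permutation characters, d^2 divides the inner
      product over the whole group, which is d; so d = 1 ([rank_cent_eq1]). *)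

Set Implicit Arguments.
Unset Strict Implicit.
Unset Printing Implicit Defensive.

Import Order.TTheory GRing.Theory Num.Theory.
Local Open Scope group_scope.
Local Open Scope ring_scope.

(** * Rotation of words in characteristic p *)

Lemma exp_sum_tuple (R : pzSemiRingType) (I : finType) (a : I -> R) N :
  (\sum_i a i) ^+ N = \sum_(t : N.-tuple I) \prod_(i <- t) a i.
Proof.
elim: N => [|N IH].
  rewrite expr0 (big_pred1 [tuple]) ?big_nil // => t /=.
  by rewrite tuple0 [RHS]eqxx.
rewrite exprS IH mulr_suml.
transitivity (\sum_i \sum_(t : N.-tuple I) \prod_(j <- i :: t) a j).
  apply: eq_bigr => i _; rewrite mulr_sumr.
  by apply: eq_bigr => t _; rewrite big_cons.
rewrite pair_big /=.
rewrite (reindex (fun u : I * N.-tuple I => cons_tuple u.1 u.2)) //=.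
exists (fun t => (thead t, [tuple of behead t])) => [[i t]|t] _ /=.
  by congr (_, _); apply/val_inj.
by rewrite [RHS]tuple_eta; apply/val_inj.
Qed.

(** The orbits that are not fixed points have an order divisible by p, so
    they contribute nothing. *)
Lemma sum_pgroup_invariant (R : nzRingType) (p : nat) (chRp : p \in [pchar R])
    (T : finType) (P : {group {perm T}}) (f : T -> R) :
  p.-group P -> (forall s x, s \in P -> f (s x) = f x) ->
  \sum_x f x = \sum_(x in 'Fix_('P)(P)) f x.
Proof.
move=> pP fP; set A := 'Fix_('P)(P).
have actsP : [acts P, on setT | 'P].
  by apply/subsetP=> s _; rewrite !inE; apply/subsetP=> x _; rewrite !inE.
have E := @set_partition_big T R 0 +%R _ _ f (orbit_partition actsP).
rewrite (eq_bigl (fun x => x \in [set: T])); last by move=> x; rewrite inE.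
rewrite {}E /=.
have orbE (B : {set T}) x : B = orbit 'P P x ->
    \sum_(y in B) f y = f x *+ #|B|.
  move=> ->; rewrite -sumr_const; apply: eq_bigr => y /orbitP[s Ps <-].
  exact: fP.
rewrite (bigID [pred B : {set T} | #|B| == 1%N]) /= [X in _ + X]big1 ?addr0.
  rewrite [RHS](eq_bigr (fun x => \sum_(y in [set x]) f y)); last first.
    by move=> x _; rewrite big_set1.
  rewrite -(big_imset (h := set1) (fun B : {set T} => \sum_(y in B) f y)) /=;
    last by move=> x y _ _; apply: set1_inj.
  apply: eq_bigl => B; apply/andP/imsetP.
    case=> /imsetP[x _ ->] /cards1P[y Ey].
    have Ex : orbit 'P P x = [set x].
      by move: (orbit_refl 'P P x); rewrite Ey => /set1P ->.
    by exists x => //; apply/orbit1P.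
  case=> x /orbit1P Ex ->; rewrite cards1; split=> //.
  by apply/imsetP; exists x; rewrite // Ex.
move=> B /andP[/imsetP[x _ Bx] B1]; rewrite (orbE _ _ Bx) Bx.
have /p_natP[[|k] E1] : p.-nat #|orbit 'P P x|.
- by rewrite card_orbit (pnat_dvd (dvdn_indexg _ _)).
- by rewrite Bx E1 in B1.
by rewrite E1 expnS mulrnA -[_ *+ p]mulr_natr (pcharf0 chRp) mulr0 mul0rn.
Qed.

Lemma rot1_tuple_inj (T : finType) N : injective (fun t : N.-tuple T => rot_tuple 1 t).
Proof. by move=> s t /(congr1 val) /= /rot_inj/val_inj. Qed.

Definition rotation_perm (T : finType) N : {perm N.-tuple T} :=
  perm (@rot1_tuple_inj T N).

Lemma rotation_permX (T : finType) N k (t : N.-tuple T) :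
  val ((rotation_perm T N ^+ k)%g t) = iter k (seq.rot 1) t.
Proof. by rewrite permX; elim: k => //= k IH; rewrite permE /= IH. Qed.

(** This is the sense in which the power map of exponent p ^ k is additive for
    noncommuting summands: a trace of a product is invariant under rotation of
    the factors, and the words fixed by rotation are the constant ones. *)
Lemma sum_rot_invariant (R : nzRingType) (p : nat) (chRp : p \in [pchar R])
    (T : finType) k (f : seq T -> R) :
  (forall x s, f (rcons s x) = f (x :: s)) ->
  \sum_(t : (p ^ k).-tuple T) f t = \sum_x f (nseq (p ^ k) x).
Proof.
move=> frot; set N := (p ^ k)%N; set r := rotation_perm T N.
have rn j x : seq.rot 1 (nseq j x) = nseq j x.
  by case: j => // j; rewrite rot1_cons; elim: j => //= j ->.
have N_gt0 : (0 < N)%N by rewrite expn_gt0 prime_gt0 // (pcharf_prime chRp).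
have fr s : f (seq.rot 1 s) = f s by case: s => // x s; rewrite rot1_cons frot.
have rN : (r ^+ N = 1)%g.
  apply/permP=> t; apply/val_inj; rewrite rotation_permX perm1.
  have iterE j : (j <= N)%N -> iter j (seq.rot 1) t = seq.rot j t.
    elim: j => [|j IH] ltjN; first by rewrite rot0.
    by rewrite iterS IH 1?ltnW // -rotS ?size_tuple.
  by rewrite iterE // rot_oversize // size_tuple.
have pr : p.-group <[r]>%G.
  rewrite /pgroup (@pnat_dvd _ N) ?pnatX ?pnat_id ?(pcharf_prime chRp) //.
  by rewrite -[#|_|]/#[r]%g order_dvdn rN.
rewrite (sum_pgroup_invariant chRp pr); last first.
  move=> _ t /cycleP[j ->]; rewrite rotation_permX.
  by elim: j => //= j; rewrite fr.
transitivity (\sum_(t in [set nseq_tuple N x | x : T]) f (tval t)).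
  apply: eq_bigl => t; apply/afixP/imsetP; last first.
    case=> x _ -> _ /cycleP[j ->]; apply/val_inj; rewrite [LHS]rotation_permX.
    by elim: j => //= j ->.
  move=> fix_t; have /(congr1 val) := fix_t r (cycle_id r).
  rewrite /= apermE permE /= => rt.
  have t_gt0 : (0 < size t)%N by rewrite size_tuple.
  case Et: (val t) rt t_gt0 => [|x s] //; rewrite rot1_cons => rt _.
  exists x => //; apply/val_inj => /=; rewrite Et.
  have <- : size (x :: s) = N by rewrite -Et size_tuple.
  move: rt; rewrite /=.
  elim: s x {Et} => //= y s IH x [<- /IH ->].
  by [].
rewrite big_imset //= => x y _ _ /(congr1 val) /=.
by move: N_gt0; case: (N) => // N' _ [].
Qed.

(** * Finite splitting fields *)

Section FiniteSplitting.
Variables (F : finFieldType) (gT : finGroupType) (G : {group gT}) (n' : nat).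
Local Notation n := n'.+1.
Variable rG : mx_representation F G n.

Definition cent_pred : pred 'M[F]_n := centgmx rG.

(** The endomorphism ring is packed as a finite ring so that Wedderburn's
    little theorem applies to it. *)
Record cent_ring := CentRing { cent_val : 'M[F]_n; _ : cent_pred cent_val }.
HB.instance Definition _ := [isSub for cent_val].
HB.instance Definition _ := [Finite of cent_ring by <:].

Lemma cent_divring_closed : divring_closed cent_pred.
Proof.
split=> [|A B /centgmxP cA /centgmxP cB|A B /centgmxP cA /centgmxP cB].
- by apply/centgmxP=> x _; rewrite mulmx1 mul1mx.
- by apply/centgmxP=> x Gx; rewrite mulmxBl mulmxBr cA ?cB.
apply/centgmxP=> x Gx; have cBx : GRing.comm (rG x) B.
  by rewrite /GRing.comm -!mulmxE cB.
have := commrV cBx; rewrite /GRing.comm -!mulmxE => cBV.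
by rewrite -mulmxA -cBV mulmxA cA // mulmxA.
Qed.

HB.instance Definition _ :=
  GRing.SubChoice_isSubUnitRing.Build _ cent_pred cent_ring cent_divring_closed.

Hypothesis irrG : mx_irreducible rG.

(** By Schur's lemma the endomorphism ring has no zero divisors. *)
Lemma centgmx_comm A B : centgmx rG A -> centgmx rG B -> A *m B = B *m A.
Proof.
move=> cA cB.
have dom : GRing.MathCompCompatIntegralDomain.IntegralDomain.axiom cent_ring.
  move=> [X cX] [Y cY] /(congr1 val) /= XY0.
  have [/eqP X0|nzX] := eqVneq X 0; first by rewrite -val_eqE /= X0.
  apply/orP; right; rewrite -val_eqE /=.
  have uX : X \in unitmx by apply: (mx_Schur irrG).
  by rewrite -[Y](mulKmx uX) [X *m Y]XY0 mulmx0.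
by have /(congr1 val) := finDomain_mulrC dom (CentRing cA) (CentRing cB).
Qed.

End FiniteSplitting.

(** The density theorem, for an endomorphism ring reduced to the scalars. *)
Lemma cent_scalar_abs_irr (F : fieldType) (gT : finGroupType) (G : {group gT})
    n (rG : mx_representation F G n) :
  mx_irreducible rG -> (forall A, centgmx rG A -> is_scalar_mx A) ->
  mx_absolutely_irreducible rG.
Proof.
move=> irrG scal; apply/andP; split; first by case/mx_irrP: irrG.
rewrite -sub1mx; apply: submx_trans (mx_Jacobson_density irrG).
apply/memmx_subP=> B _; apply/cent_mxP=> A; rewrite memmx_cent_envelop.
by move=> /scal/is_scalar_mxP[a ->]; rewrite scalar_mxC.
Qed.

(** Each factor A - c_i is an endomorphism, hence zero or invertible. *)
Lemma cent_annihilated_is_scalar (F : fieldType) (gT : finGroupType)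
    (G : {group gT}) n' (rG : mx_representation F G n'.+1)
    (I : finType) (c : I -> F) (A : 'M_n'.+1) :
  mx_irreducible rG -> centgmx rG A ->
  horner_mx A (\prod_i ('X - (c i)%:P)) = 0 -> is_scalar_mx A.
Proof.
move=> irrG cA; rewrite rmorph_prod /=.
have [/existsP[i /eqP/subr0_eq->]|] := boolP [exists i, A - (c i)%:M == 0].
  by rewrite scalar_mx_is_scalar.
rewrite negb_exists => /forallP nz prod0.
suff : (\prod_i horner_mx A ('X - (c i)%:P)) \is a GRing.unit.
  by rewrite prod0 unitr0.
apply: rpred_prod => i _; rewrite rmorphB /= horner_mx_X horner_mx_C.
apply: (mx_Schur irrG); last exact: nz.
apply/centgmxP=> y Gy.
by rewrite mulmxBl mulmxBr (centgmxP cA) // scalar_mxC.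
Qed.

Lemma centgmx_average (F : fieldType) (gT : finGroupType) (G : {group gT})
    n (rG : mx_representation F G n) (X : 'M_n) :
  centgmx rG (\sum_(g in G) rG g^-1%g *m X *m rG g).
Proof.
apply/centgmxP=> x Gx; rewrite mulmx_suml mulmx_sumr.
rewrite (reindex_inj (mulIg x^-1)%g) /=.
apply: eq_big => [g|g Gg]; first by rewrite groupMr ?groupV.
have{}Gg : g \in G by rewrite -(groupMr g (groupVr Gx)).
rewrite invMg invgK !repr_mxM ?groupV //.
by rewrite !mulmxA repr_mxKV.
Qed.

(** For A and C in the endomorphism ring, tr (A^Q C) = tr (A C) because the
    expansion of A^Q in group elements may be rotated.  The trace form is
    nondegenerate on the endomorphism ring since averaging over G preserves
    traces, whence A^Q = A and A is a root of 'X^Q - 'X, which splits. *)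
Lemma finite_field_splitting (F : finFieldType) (gT : finGroupType)
    (G : {group gT}) :
  [pchar F]^'.-group G -> (exponent G %| #|F|.-1)%N ->
  group_splitting_field F G.
Proof.
move=> F'G expG [|n'] rG irrG; first by have [] := (mx_irrP _).1 irrG.
apply: cent_scalar_abs_irr => // A cA.
set Q := #|F|; have Q_gt1 : (1 < Q)%N by apply: finNzRing_gt1.
have [p p_pr chFp] := finPcharP F.
have [k oF] : exists k, Q = (p ^ k)%N by eexists; exact: (card_pprimeChar chFp).
have [c defA] : exists c, A = \sum_(x in G) c x *: rG x.
  apply/envelop_mxP; apply: submx_trans (mx_Jacobson_density irrG).
  apply/cent_mxP=> B; rewrite memmx_cent_envelop => cB.
  exact: (centgmx_comm irrG).
(* Extending by 0 outside G lets words range over tuples of a finite type. *)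
pose a x := if x \in G then c x *: rG x else 0.
have {}defA : A = \sum_x a x by rewrite defA big_mkcond.
have aQ x : a x ^+ Q = a x.
  rewrite /a; case: ifP => [Gx|_]; last by rewrite expr0n -(subnKC Q_gt1).
  rewrite exprZn -repr_mxX // expf_card; congr (_ *: rG _).
  rewrite -(prednK (ltnW Q_gt1)) expgS.
  by have /dvdnP[j ->] := expG; rewrite mulnC expgM expg_exponent // expg1n mulg1.
have trQ C : centgmx rG C -> \tr (A ^+ Q *m C) = \tr (A *m C).
  move=> /centgmxP cC.
  pose f (s : seq gT) := \tr ((\prod_(x <- s) a x) *m C).
  have frot x s : f (rcons s x) = f (x :: s).
    rewrite /f big_cons -cats1 big_cat big_seq1 /= -!mulmxE -mulmxA.
    rewrite -(mulmxA (a x)) (mxtrace_mulC (a x)) -mulmxA; congr (\tr (_ *m _)).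
    rewrite /a; case: ifP => [Gx|_]; last by rewrite mulmx0 mul0mx.
    by rewrite -scalemxAl -scalemxAr cC.
  have := sum_rot_invariant chFp k frot.
  rewrite -oF /f -!raddf_sum -!mulmx_suml -exp_sum_tuple -defA => ->.
  congr (\tr (_ *m C)); rewrite [RHS]defA; apply: eq_bigr => x _.
  by rewrite big_nseq -[RHS]aQ; elim: (Q) => //= j ->; rewrite exprS.
have divc := cent_divring_closed rG.
have cX j : centgmx rG (A ^+ j).
  apply/centgmxP=> x Gx; apply: (commr_sym (commrX _ (commr_sym _))).
  exact: (centgmxP cA).
have AQ : A ^+ Q = A.
  apply/eqP; rewrite -subr_eq0; apply: contraT => nzB; set B := _ - A in nzB.
  have cB : centgmx rG B by have [_ sub _] := divc; exact: (sub _ _ (cX Q) cA).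
  (* C0 is an endomorphism of trace #|G|, a nonzero element of F. *)
  pose C0 := \sum_(g in G) rG g^-1%g *m delta_mx 0 0 *m rG g.
  have cC : centgmx rG (C0 / B).
    have [_ _ div] := divc.
    exact: (div _ _ (centgmx_average rG (delta_mx 0 0)) cB).
  have := trQ _ cC => /eqP; rewrite -subr_eq0 -raddfB -mulmxBl -/B.
  rewrite /= mxtrace_mulC -/(_ / B * B) -mulmxE.
  rewrite -mulmxA [_^-1 *m B]mulVmx ?(mx_Schur irrG) // mulmx1 raddf_sum /=.
  rewrite (eq_bigr (fun=> 1)) => [|g Gg].
    by rewrite sumr_const; move: F'G; rewrite /pgroup pcharf'_nat => /negPf->.
  rewrite mxtrace_mulC mulmxA -repr_mxM ?groupV // mulgV repr_mx1 mul1mx.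
  rewrite /mxtrace (bigD1 0) //= big1 ?addr0 ?mxE ?eqxx // => i i0.
  by rewrite mxE (negPf i0).
apply: (cent_annihilated_is_scalar (c := id) irrG cA).
by rewrite -finField_genPoly rmorphB rmorphXn /= horner_mx_X AQ subrr.
Qed.

(** * Splitting in positive characteristic *)

Section FiniteSubfield.
Variables (K : fieldType) (s : seq K).

(** The closure proof is a phantom argument: it is what makes the field
    structure of the type inferable. *)
Definition fin_subfield of divring_closed (mem s) : Type := seq_sub s.
Hypothesis closed_s : divring_closed (mem s).
Local Notation F := (fin_subfield closed_s).

HB.instance Definition _ := SubType.copy F (seq_sub s).
HB.instance Definition _ := Finite.copy F (seq_sub s).
HB.instance Definition _ :=
  GRing.SubChoice_isSubIntegralDomain.Build K (mem s) F closed_s.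
HB.instance Definition _ :=
  GRing.SubIntegralDomain_isSubField.Build K (mem s) F (frefl _).
End FiniteSubfield.

Lemma poly_root_seq (K : idomainType) (P : {poly K}) : P != 0 ->
  exists s : seq K, forall x, (x \in s) = root P x.
Proof.
move=> nzP.
pose Q m := `[< exists s : seq K, [/\ uniq s, all (root P) s & size s = m] >].
have Q0 : exists m, Q m by exists 0%N; apply/asboolP; exists [::].
have Qub m : Q m -> (m <= size P)%N.
  by case/asboolP=> s [us rs <-]; apply: ltnW; apply: max_poly_roots.
case: (ex_maxnP Q0 Qub) => m /asboolP[s [us rs sm]] maxm.
exists s => x; apply/idP/idP=> [|rx]; first exact: (allP rs).
apply: contraT => sx; have := maxm m.+1; rewrite ltnn => -> //.
by apply/asboolP; exists (x :: s); rewrite /= sx rx us sm.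
Qed.

(** The fixed field of x |-> x^Q, with Q = p ^ totient e, is finite and
    contains the e-th roots of unity by Euler's theorem; a splitting field
    remains one after extension. *)
Lemma pchar_splitting (K : fieldType) (p : nat) (gT : finGroupType)
    (G : {group gT}) (z : K) :
  p \in [pchar K] -> [pchar K]^'.-group G ->
  (exponent G).-primitive_root z -> group_splitting_field K G.
Proof.
move=> chKp K'G ez; set e := exponent G in ez.
have p_pr := pcharf_prime chKp.
have co_pe : coprime p e.
  rewrite prime_coprime //; apply/negP=> pe.
  by have := K'G; rewrite -pnat_exponent => /(pnat_dvd pe);
     rewrite pnatE // inE /= chKp.
pose Q := (p ^ totient e)%N.
have Q_gt1 : (1 < Q)%N.
  by rewrite -[1%N](expn0 p) ltn_exp2l ?prime_gt1 // totient_gt0 exponent_gt0.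
have [s sP] : exists s : seq K, forall x, (x \in s) = (x ^+ Q == x).
  have nzP : 'X^Q - 'X != 0 :> {poly K}.
    by rewrite -size_poly_eq0 size_polyDl size_polyXn // size_polyN size_polyX.
  have [s sP] := poly_root_seq nzP; exists s => x.
  by rewrite sP rootE !hornerE subr_eq0.
have powD : {morph (fun x : K => x ^+ Q) : x y / x - y}.
  move=> x y; rewrite exprDn_pchar ?pnatX ?pnatE ?chKp //; congr (_ + _).
  apply/eqP; rewrite -addr_eq0 -exprDn_pchar ?pnatX ?pnatE ?chKp //.
  by rewrite addNr expr0n -(subnKC Q_gt1).
have cs : divring_closed (mem s).
  have sP' x : (x \in mem s) = (x ^+ Q == x) by exact: sP.
  split=> [|x y|x y]; rewrite !sP' ?expr1n //.
    by move=> /eqP xQ /eqP yQ; apply/eqP; rewrite [LHS]powD xQ yQ.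
  by move=> /eqP xQ /eqP yQ; rewrite exprMn exprVn xQ yQ.
pose F : finFieldType := fin_subfield cs.
pose f : {rmorphism F -> K} := \val.
apply: (extend_group_splitting_field f).
have sz : z \in s.
  rewrite sP -(prim_expr_mod ez) -/Q Euler_exp_totient //.
  by rewrite (prim_expr_mod ez) expr1.
have nz_z : z != 0.
  apply/eqP=> z0; have /esym/eqP := prim_expr_order ez.
  by rewrite z0 expr0n gtn_eqF ?exponent_gt0 // oner_eq0.
apply: finite_field_splitting.
  have fch : [pchar F] =i [pchar K] by move=> j; rewrite (fmorph_pchar f).
  by rewrite (eq_pgroup _ (eq_negn fch)).
pose u : F := SeqSub sz.
(* z has order e in the multiplicative group of the subfield. *)
rewrite -/e (prim_order_dvd ez) -[z]/(f u) -rmorphXn fmorph_eq1.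
rewrite -(inj_eq (mulIf (_ : u != 0))) ?mul1r; last by rewrite -(fmorph_eq0 f).
by rewrite -exprSr prednK ?expf_card // ltnW ?finNzRing_gt1.
Qed.

(** When n is invertible, 'X^n - 1 is separable, so its n roots are distinct
    and form a cyclic group. *)
Lemma exists_prim_root (K : fieldType) n (s : seq K) : n%:R != 0 :> K ->
  'X^n - 1 = \prod_(z <- s) ('X - z%:P) -> exists z : K, n.-primitive_root z.
Proof.
move=> nz sE; have n_gt0 : (0 < n)%N by case: n nz {sE}; rewrite ?eqxx.
have us : uniq s.
  by rewrite -separable_prod_XsubC -sE separable_Xn_sub_1.
have ss : size s = n.
  by apply/succn_inj; rewrite -(size_prod_XsubC s id) -sE size_XnsubC.
have /hasP[z _ pz] : has n.-primitive_root s; last by exists z.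
apply: has_prim_root; rewrite ?ss //; apply/allP=> z sz.
have : root ('X^n - 1) z by rewrite sE root_prod_XsubC.
by [].
Qed.

(** * Groups with a cyclic normal subgroup and nilpotent quotient *)

(** This class contains the quasi-elementary groups for all primes at once;
    being closed under subgroups and quotients it supports an induction. *)
Definition cyclic_by_nilpotent (gT : finGroupType) (G : {group gT}) :=
  exists C : {group gT}, [/\ C <| G, cyclic C & nilpotent (G / C)].

Lemma cyclic_by_nilpotentS (gT : finGroupType) (G H : {group gT}) :
  H \subset G -> cyclic_by_nilpotent G -> cyclic_by_nilpotent H.
Proof.
move=> sHG [C [nsCG cycC nilGC]]; exists (H :&: C)%G; split.
- exact: (normalGI sHG nsCG).
- exact: cyclicS (subsetIr _ _) cycC.
have nCH : H \subset 'N(C) := subset_trans sHG (normal_norm nsCG).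
rewrite /= setIC (isog_nil (second_isog nCH)).
exact: nilpotentS (quotientS C sHG) nilGC.
Qed.

Lemma nilpotent_quotientS (gT : finGroupType) (G H K : {group gT}) :
  H <| G -> K <| G -> H \subset K -> nilpotent (G / H) -> nilpotent (G / K).
Proof.
move=> nsHG nsKG sHK nilG.
by rewrite -(isog_nil (third_isog sHK nsHG nsKG)) quotient_nil.
Qed.

Lemma cyclic_by_nilpotent_quotient (gT : finGroupType) (G H : {group gT}) :
  H <| G -> cyclic_by_nilpotent G -> cyclic_by_nilpotent (G / H).
Proof.
move=> nsHG [C [nsCG cycC nilGC]]; exists (C / H)%G; split.
- exact: quotient_normal nsCG.
- exact: quotient_cyclic.
have nHC : C \subset 'N(H) := subset_trans (normal_sub nsCG) (normal_norm nsHG).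
have nsCHG : (C <*> H)%G <| G by apply: normalY.
have -> : (C / H)%G = ((C <*> H)%G / H)%G :> {group _}.
  by apply/val_inj; rewrite /= quotientYidr.
rewrite (isog_nil (third_isog _ nsHG nsCHG)) ?joing_subr //.
exact: nilpotent_quotientS (joing_subl _ _) nilGC.
Qed.

(** If C is central then G is nilpotent; a noncentral element of the second
    center generates, together with the center, an abelian normal subgroup. *)
Lemma cyclic_by_nilpotent_abelian_normal (gT : finGroupType) (G : {group gT}) :
  cyclic_by_nilpotent G -> ~~ abelian G ->
  exists A : {group gT}, [/\ A <| G, abelian A & ~~ (A \subset 'Z(G))].
Proof.
case=> C [nsCG cycC nilGC] nabG.
have [sCZ|nCZ] := boolP (C \subset 'Z(G)); last first.
  by exists C; split=> //; apply: cyclic_abelian.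
have nilG : nilpotent G.
  rewrite -quotient_center_nil.
  exact: nilpotent_quotientS nsCG (center_normal G) sCZ nilGC.
have [sZ2|] := boolP ('Z_2(G) \subset 'Z(G)).
  have /eqP : 'Z(G / 'Z(G)) = 1%g.
    have := ucn_central 1 G; rewrite ucn1 => <-.
    by apply/trivgP; rewrite -(trivg_quotient 'Z(G)) quotientS.
  rewrite center_nil_eq1 ?quotient_nil // -subG1 quotient_sub1 ?gFnorm //.
  by rewrite subsetI => /andP[_ cGG]; case/negP: nabG.
case/subsetPn=> x Z2x nZx; exists (<[x]> <*> 'Z(G))%G.
have Gx : x \in G by apply: subsetP (ucn_sub 2 G) x Z2x.
have cZx : 'Z(G) \subset 'C(<[x]>).
  by rewrite centsC cycle_subG; apply: subsetP Gx; rewrite centsC subsetIr.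
split.
- rewrite /normal join_subG cycle_subG Gx center_sub /= -commg_subl.
  apply: subset_trans (joing_subr _ _).
  rewrite -ucn1; apply: subset_trans (ucn_comm 1 G); apply: commSg.
  by have := ucn_subS 1 G; rewrite ucn1 join_subG cycle_subG Z2x.
- by rewrite /= cent_joinEr // abelianM cycle_abelian center_abelian /=.
by apply: contra nZx => /subsetP-> //; rewrite mem_gen // inE cycle_id.
Qed.

Section Scalars.
Variables (K : fieldType) (gT : finGroupType).

Lemma central_is_scalar (G : {group gT}) n (rG : mx_representation K G n)
    (z : K) e x :
  e.-primitive_root z -> mx_irreducible rG -> x \in 'Z(G) -> (x ^+ e = 1)%g ->
  is_scalar_mx (rG x).
Proof.
case: n rG => [|n'] rG ez irrG Zx xe.
  by have [] := (mx_irrP _).1 irrG.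
have [Gx cGx] := centerP _ _ Zx.
have cx : centgmx rG (rG x).
  by apply/centgmxP=> y Gy; rewrite -!repr_mxM // cGx.
apply: (cent_annihilated_is_scalar (c := fun i : 'I_e => z ^+ i) irrG cx).
have <- : 'X^e - 1 = \prod_(i < e) ('X - (z ^+ i)%:P).
  by rewrite -(factor_Xn_sub_1 ez) big_mkord.
rewrite rmorphB rmorphXn rmorph1 /= horner_mx_X -repr_mxX // xe repr_mx1.
exact: subrr.
Qed.

(** Every simple module of A isomorphic to U is the image of U under an
    A-homomorphism, and x acts on U by a scalar. *)
Lemma component_abelian_scalar (A : {group gT}) n
    (rA : mx_representation K A n) (z : K) e (U : 'M_n) x :
  abelian A -> e.-primitive_root z -> mxsimple rA U -> x \in A ->
  (x ^+ e = 1)%g ->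
  exists c, component_mx rA U *m rA x = c *: component_mx rA U.
Proof.
move=> cAA ez simU Ax xe; have modU := mxsimple_module simU.
have irrU : mx_irreducible (submod_repr modU) by apply/submod_mx_irr.
have Zx : x \in 'Z(A) by rewrite (center_idP cAA).
have /is_scalar_mxP[c rUx] := central_is_scalar ez irrU Zx xe.
have Ux : U *m rA x = c *: U.
  rewrite -{1 2}(in_submodK (submx_refl U)) -val_submodJ // rUx.
  by rewrite mul_mx_scalar /val_submod /= -scalemxAl.
exists c; have [I [W isoW ->]] := component_mx_def simU.
have /submxP[D ->] : (\sum_i W i <= \sum_i W i)%MS by [].
apply/eqP; rewrite -subr_eq0 -mul_mx_scalar -mulmxBr; apply/eqP/sub_kermxP.
rewrite (submx_trans (submxMl _ _)) //; apply/sumsmx_subP=> i _.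
have [f _ homf defW] := isoW i.
rewrite -defW; apply/sub_kermxP; rewrite mulmxBr mul_mx_scalar.
by rewrite -(hom_mxP homf) // Ux -scalemxAl subrr.
Qed.
End Scalars.

(** * Clifford reduction to the stabilizer of a component *)

Section CliffordStabilizer.
Variables (K : fieldType) (gT : finGroupType) (G A : {group gT}) (n : nat).
Variables (rG : mx_representation K G n) (nsAG : A <| G).
Hypothesis irrG : mx_irreducible rG.
Let rA := subg_repr rG (normal_sub nsAG).
Variables (sA : socleType rA) (W : sA).
Local Notation T := (rstabs_group rG W).

Lemma Clifford_stab_sub : T \subset G. Proof. exact: rstabs_sub. Qed.

(** If U is a nonzero submodule of W for the stabilizer T, its translates span
    the whole space, and there are at most as many of them as components; a
    comparison of dimensions gives U = W. *)
Lemma Clifford_stab_simple :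
  mxsimple (subg_repr rG Clifford_stab_sub) W.
Proof.
split; first by apply/mxmoduleP=> x; rewrite inE => /andP[].
  exact: nz_socle.
move=> U /mxmoduleP modU sUW nzU.
have transW W' : exists x, (x \in G) && ('Cl%act W x == W').
  have /imsetP[W0 _ E] := Clifford_atrans irrG sA.
  have /orbitP[x Gx xW] : W \in orbit ('Cl)%act G W0 by rewrite -E inE.
  have /orbitP[y Gy yW'] : W' \in orbit ('Cl)%act G W0 by rewrite -E inE.
  exists (x^-1 * y)%g; rewrite groupM ?groupV // andTb; apply/eqP.
  rewrite (actMin ('Cl)%act) ?groupV //.
  by rewrite (canLR (actKin ('Cl)%act Gx) (esym xW)).
pose g W' := xchoose (transW W').
have Gg W' : g W' \in G by case/andP: (xchooseP (transW W')).
have gW W' : ('Cl)%act W (g W') = W'.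
  by case/andP: (xchooseP (transW W')) => _ /eqP.
pose S := (\sum_(W' : sA) U *m rG (g W'))%MS.
have sUS x : x \in G -> (U *m rG x <= S)%MS.
  move=> Gx; set W' := ('Cl)%act W x.
  apply: (sumsmx_sup W') => //.
  have Tx : (x * (g W')^-1)%g \in T.
    have Gxg : (x * (g W')^-1)%g \in G by rewrite groupM ?groupV.
    rewrite inE Gxg /= -(val_Clifford_act W Gxg).
    rewrite (actMin ('Cl)%act) ?groupV // -/W'.
    by rewrite (canLR (actKin ('Cl)%act (Gg W')) (esym (gW W'))).
  rewrite -(mulgKV (g W') x) repr_mxM ?groupM ?groupV // mulmxA.
  exact: submxMr (modU _ Tx).
have full_S : (1%:M <= S)%MS.
  have modS : mxmodule rG S.
    apply/mxmoduleP=> x Gx; rewrite sumsmxMr; apply/sumsmx_subP=> W' _.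
    by rewrite -mulmxA -repr_mxM // sUS ?groupM.
  have [_ _ simG] := irrG; apply: simG; rewrite ?submx1 //.
  apply: contraNneq nzU => S0; have := sUS 1%g (group1 G).
  by rewrite repr_mx1 mulmx1 S0 submx0.
have rkS : (\rank W * #|sA| <= \rank U * #|sA|)%N.
  rewrite mulnC (Clifford_rank_components irrG W).
  apply: leq_trans (_ : \rank S <= _)%N.
    by rewrite -[X in (X <= _)%N](mxrank1 K) mxrankS.
  apply: leq_trans (mxrank_sum_leqif _).1 _ => /=.
  rewrite mulnC -sum_nat_const; apply: leq_sum => W' _.
  by rewrite mxrankMfree ?repr_mx_free.
have sA_gt0 : (0 < #|sA|)%N by apply/card_gt0P; exists W.
by rewrite -(geq_leqif (mxrank_leqif_sup sUW)) -(leq_pmul2r sA_gt0).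
Qed.

(** An endomorphism B of rG preserves the component W and restricts to a
    scalar c on it; then B - c is an endomorphism that kills W, so it is 0. *)
Lemma Clifford_stab_cent_scalar (B : 'M_n) :
  mx_absolutely_irreducible
    (submod_repr (mxsimple_module Clifford_stab_simple)) ->
  centgmx rG B -> is_scalar_mx B.
Proof.
move=> absW cB; have cBA : centgmx rA B.
  by apply/centgmxP=> x Ax; apply: (centgmxP cB); apply: (subsetP (normal_sub nsAG)).
have sWB : (val_submod (1%:M : 'M_(\rank W)) *m B <= W)%MS.
  have sWBW : (W *m B <= W)%MS.
    by apply: hom_component_mx; [apply: socle_simple | apply: centgmx_hom].
  by apply: submx_trans sWBW; apply: submxMr; rewrite val_submod1.
have cW : centgmx (submod_repr (mxsimple_module Clifford_stab_simple))
    (in_submod W (val_submod (1%:M : 'M_(\rank W)) *m B)).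
  apply/centgmxP=> x Tx; apply: (can_inj (@val_submodK _ _ W _)).
  rewrite val_submodJ // (in_submodK sWB) -mulmxA.
  rewrite (centgmxP cB) ?(subsetP Clifford_stab_sub) // mulmxA.
  have valM (P Q : 'M_(\rank W)) : val_submod (P *m Q) = P *m val_submod Q.
    by rewrite val_submodE [in RHS]val_submodE mulmxA.
  rewrite valM (in_submodK sWB) mulmxA; congr (_ *m _).
  by rewrite -(val_submodJ (mxsimple_module Clifford_stab_simple)) // -valM mulmx1 mul1mx.
have /is_scalar_mxP[c Bc] := mx_abs_irr_cent_scalar absW cW.
have : val_submod (1%:M : 'M_(\rank W)) *m (B - c%:M) = 0 :> 'M_(\rank W, n).
  rewrite mulmxBr -(in_submodK sWB) Bc mul_mx_scalar.
  by rewrite val_submodE mul_scalar_mx subrr.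
have [/subr0_eq-> _|nzB] := eqVneq (B - c%:M) 0; first exact: scalar_mx_is_scalar.
have uB : B - c%:M \in unitmx.
  apply: (mx_Schur irrG) => //; apply/centgmxP=> x Gx.
  by rewrite mulmxBl mulmxBr (centgmxP cB) // scalar_mxC.
move/(congr1 (mulmxr (invmx (B - c%:M)))); rewrite /= mulmxK // mul0mx => /eqP.
by rewrite -mxrank_eq0 val_submod1 mxrank_eq0 (negPf (nz_socle W)).
Qed.
End CliffordStabilizer.

(** Induction on the order: pass to the quotient if rG is not faithful, and to
    the stabilizer of a component of a noncentral abelian normal subgroup A if
    G is not abelian.  The stabilizer is proper, for A would act by scalars on
    a component equal to the whole space. *)
Lemma cyclic_by_nilpotent_splitting (K : fieldType) (gT : finGroupType)
    (G : {group gT}) :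
  (exists z : K, (exponent G).-primitive_root z) -> cyclic_by_nilpotent G ->
  group_splitting_field K G.
Proof.
have [N] := ubnP #|G|; elim: N => // N IH in gT G *.
rewrite ltnS => leGN [z ez] cnG n rG irrG.
have dvd_root (hT : finGroupType) (H : {group hT}) :
    (exponent H %| exponent G)%N -> exists y : K, (exponent H).-primitive_root y.
  move=> dv; exists (z ^+ (exponent G %/ exponent H)).
  exact: (dvdn_prim_root ez dv).
have [kG1|nkG1] := boolP (mx_faithful rG); last first.
  have nsKG := rker_normal rG.
  have ltKG : (#|G / rker rG|%g < #|G|)%N.
    by rewrite ltn_quotient ?rstab_sub //; rewrite /mx_faithful subG1 in nkG1.
  have abs := IH _ (G / rker_group rG)%G (leq_trans ltKG leGN)
    (dvd_root _ _ (exponent_quotient _ _)) (cyclic_by_nilpotent_quotient nsKG cnG).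
  have := abs _ (kquo_repr rG) ((quo_mx_irr _ _).2 irrG).
  by rewrite /mx_absolutely_irreducible /row_full (quo_mx_quotient _ _).
have [abG|nabG] := boolP (abelian G).
  have cycG := mx_faithful_irr_abelian_cyclic kG1 irrG abG.
  apply: (primitive_root_splitting_abelian (z := z)) irrG => //.
  by rewrite -exponent_cyclic.
have [A [nsAG abA nZA]] := cyclic_by_nilpotent_abelian_normal cnG nabG.
have sAG := normal_sub nsAG.
apply: (socle_exists (subg_repr rG (normal_sub nsAG))) => sA.
have [W _] : exists W : sA, true.
  have /imsetP[W _ _] := Clifford_atrans irrG sA; by exists W.
apply: cent_scalar_abs_irr => // B cB.
apply: (Clifford_stab_cent_scalar (W := W)) cB => //.
set T := (rstabs_group rG W); have sTG : T \subset G := rstabs_sub _ _.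
have properT : T \proper G.
  rewrite properEneq sTG andbT; apply: contraNneq nZA => defT.
  have modW : mxmodule rG W.
    have sGT : G \subset T by rewrite defT.
    by apply/mxmoduleP=> x /(subsetP sGT); rewrite inE => /andP[].
  have fullW : (1%:M <= W)%MS.
    by have [_ _ simG] := irrG; apply: simG; rewrite ?submx1 ?nz_socle.
  apply/subsetP=> a Aa; have Ga := subsetP sAG a Aa.
  have ae : (a ^+ exponent G = 1)%g by apply: expg_exponent.
  have [c Wa] := component_abelian_scalar abA ez (socle_simple W) Aa ae.
  have rGa : rG a = c%:M.
    have /submxP[D defD] := fullW.
    rewrite -[LHS]mul1mx defD -mulmxA [_ *m rG a]Wa -scalemxAr -defD.
    by rewrite scalemx1.
  apply/centerP; split=> // x Gx; apply: (mx_faithful_inj kG1); rewrite ?groupM //.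
  by rewrite !repr_mxM // rGa scalar_mxC.
apply: (IH _ T).
- exact: leq_trans (proper_card properT) leGN.
- exact/dvd_root/exponentS.
- exact: cyclic_by_nilpotentS cnG.
by apply/submod_mx_irr; apply: Clifford_stab_simple.
Qed.

(** * Permutation characters on cosets *)

Section PermChar.
Variables (gT : finGroupType).
Implicit Types (G H N : {group gT}).

Definition perm_char (H G : {set gT}) (x : gT) : nat :=
  #|'Fix_(rcosets H G | 'Rs)[x]|.

Lemma fix_rcoset H (x g : gT) :
  (('Rs)%act (H :* g) x == H :* g) = (x ^ g^-1 \in H)%g.
Proof.
rewrite /= rcosetE -rcosetM.
apply/eqP/idP => [E|Hx].
  have := rcoset_refl H (g * x)%g; rewrite E mem_rcoset => hx.
  by rewrite conjgE invgK mulgA.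
by apply/rcoset_eqP; rewrite mem_rcoset; move: Hx; rewrite conjgE invgK mulgA.
Qed.

Lemma acts_rcosets_Rs G H : [acts G, on rcosets H G | 'Rs].
Proof.
apply/subsetP=> x Gx; rewrite !inE; apply/subsetP=> B.
case/rcosetsP=> g Gg ->; rewrite inE; apply/rcosetsP.
by exists (g * x)%g; rewrite ?groupM //= rcosetE rcosetM.
Qed.

(** The p-part of x acts on the cosets fixed by its p'-part. *)
Lemma perm_char_mod_constt G H x p : x \in G ->
  perm_char H G x = perm_char H G x.`_p^' %[mod p].
Proof.
move=> Gx; set c := x.`_p^'; set d := x.`_p.
have Gc : c \in G by rewrite groupX.
have Gd : d \in G by rewrite groupX.
have pd : p.-group <[d]> by apply: p_elt_constt.
have defx : x = (d * c)%g by rewrite consttC.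
have cdc : commute d c by apply: commuteX2.
set S := 'Fix_(rcosets H G | 'Rs)[c].
have actS : [acts <[d]>, on S | 'Rs].
  rewrite cycle_subG; apply/setIdP; split; rewrite ?inE //; apply/subsetP=> B.
  case/setIP=> XB /afix1P Bc; rewrite inE; apply/setIP; split.
    by rewrite (actsP (acts_rcosets_Rs G H)).
  by apply/afix1P; rewrite -!actM cdc actM Bc.
rewrite [RHS](pgroup_fix_mod pd actS) /perm_char.
congr (#|pred_of_set _| %% _)%N; apply/setP=> B; rewrite afix_cycle /S.
rewrite !in_setI; case: (B \in rcosets H G) => //=.
apply/afix1P/andP => [Bx|[/afix1P Bc /afix1P Bd]]; last first.
  by rewrite defx actM Bd Bc.
have fixX k : ('Rs)%act B (x ^+ k)%g = B.
  by elim: k => [|k IH]; rewrite ?act1 // expgS actM Bx.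
by split; apply/afix1P; apply: fixX.
Qed.

(** Let c be the p'-part of x and H the product of <[c]> with a Sylow
    p-subgroup of N = 'N_G(<[c]>).  As <[c]> is the normal p-complement of H,
    the cosets of H fixed by c are those contained in N, and #|N : H| is prime
    to p.  H belongs to the class excluded for G, so it is proper. *)
Lemma not_cyclic_by_nilpotent_perm_char G x p :
  prime p -> x \in G -> ~ cyclic_by_nilpotent G ->
  exists2 H : {group gT}, H \proper G & ~~ (p %| perm_char H G x)%N.
Proof.
move=> p_pr Gx ncnG; set c := x.`_p^'.
have Gc : c \in G by rewrite groupX.
set C := <[c]>; set N := 'N_G(C).
have [P sylP] := Sylow_exists p N; have [sPN pP _] := and3P sylP.
have sCN : C \subset N by rewrite subsetI cycle_subG Gc normG.
have nCP : P \subset 'N(C) := subset_trans sPN (subsetIr _ _).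
pose H := (C <*> P)%G.
have sHN : H \subset N by rewrite join_subG sCN.
have sHG : H \subset G := subset_trans sHN (subsetIl _ _).
have nsCH : C <| H by rewrite /normal joing_subl join_subG normG.
have pHC : p.-group (H / C) by rewrite /= quotientYidl // quotient_pgroup.
exists H.
  rewrite properEneq sHG andbT; apply: contra_notN ncnG => /eqP defG.
  exists (cycle_group c); split; first by rewrite -defG.
    exact: cycle_cyclic.
  by rewrite -defG; apply: pgroup_nil pHC.
rewrite /dvdn (perm_char_mod_constt H p Gx) -/c -/(dvdn _ _).
suff -> : perm_char H G c = #|N : H|.
  have p'NP : ~~ (p %| #|N : P|)%N by rewrite -p'natE //; case/and3P: sylP.
  by apply: contra p'NP => /dvdn_trans-> //; rewrite indexgS // joing_subr.
rewrite /perm_char /indexg; apply: eq_card => B.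
apply/setIP/rcosetsP => [[/rcosetsP[g Gg ->] /afix1P/eqP]|[g Ng ->]].
  rewrite fix_rcoset // => Hcg; exists g => //.
  have Ccg : (c ^ g^-1 \in C)%g.
    have Ncg : (c ^ g^-1 \in 'N(C))%g by apply: subsetP (normal_norm nsCH) _ Hcg.
    apply: coset_idr => //; apply/eqP; rewrite -order_eq1 -dvdn1.
    have p_ : p.-elt (coset C (c ^ g^-1)) by apply: mem_p_elt pHC _; apply: mem_quotient.
    have p'_ : p^'.-elt (coset C (c ^ g^-1)).
      by apply: morph_p_elt => //; rewrite p_eltJ p_elt_constt.
    by rewrite (pnat_1 p_ p'_).
  rewrite inE Gg -groupV; apply/normP/eqP.
  by rewrite eqEcard cardJg leqnn -cycleJ cycle_subG Ccg.
have [Gg nCg] := setIP Ng; split; first by apply/rcosetsP; exists g.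
apply/afix1P/eqP; rewrite fix_rcoset //.
apply: (subsetP (joing_subl C P)); rewrite memJ_norm ?groupV ?cycle_id //.
Qed.

(** Frobenius reciprocity for the trivial character of H. *)
Lemma sum_perm_char (R : nzRingType) G H (f : gT -> R) :
  H \subset G -> {in G &, forall x y, f (x ^ y)%g = f x} ->
  \sum_(x in G) (perm_char H G x)%:R * f x =
    (\sum_(h in H) f h) *+ #|G : H|.
Proof.
move=> sHG cf.
transitivity (\sum_(x in G) \sum_(B in rcosets H G)
    (('Rs)%act B x == B)%:R * f x).
  apply: eq_bigr => x Gx; rewrite -mulr_suml; congr (_ * _).
  rewrite -natr_sum /perm_char -sum1_card big_mkcond [in RHS]big_mkcond /=.
  congr _%:R; apply: eq_bigr => B _; rewrite in_setI.
  case: (B \in rcosets H G) => //=.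
  by rewrite (sameP afix1P eqP); case: (_ == _).
rewrite exchange_big /= -sumr_const; apply: eq_bigr => _ /rcosetsP[g Gg ->].
rewrite (reindex_inj (conjg_inj g)) /=.
rewrite [RHS]big_mkcond [LHS]big_mkcond; apply: eq_bigr => x _.
rewrite groupJr // -[rcoset _ _ == _]/(('Rs)%act (H :* g) (x ^ g)%g == H :* g).
rewrite fix_rcoset conjgK.
have [Hx|nHx] := boolP (x \in H); last by rewrite mul0r if_same.
by rewrite (subsetP sHG) // mul1r cf // (subsetP sHG).
Qed.
End PermChar.

Section PermRepr.
Variables (K : fieldType) (gT : finGroupType) (G : {group gT}).
Variables (sT : finType) (to : {action gT &-> sT}) (S : {set sT}).
Hypothesis actS : [acts G, on S | to].

Definition perm_repr_mx (x : gT) : 'M[K]_#|S| :=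
  \matrix_(i, j) (to (enum_val i) x == enum_val j)%:R.

Lemma perm_repr_mx_repr : mx_repr G perm_repr_mx.
Proof.
split=> [|x y Gx Gy].
  by apply/matrixP=> i j; rewrite !mxE act1 (inj_eq enum_val_inj).
apply/matrixP=> i j; rewrite !mxE.
have Si : to (enum_val i) x \in S by rewrite (actsP actS) ?enum_valP.
rewrite (bigD1 (enum_rank_in Si (to (enum_val i) x))) //= big1 ?addr0.
  by rewrite !mxE enum_rankK_in // eqxx mul1r actM.
move=> k ne; rewrite mxE; case: eqP => [E|_]; last by rewrite mul0r.
by case/eqP: ne; apply: enum_val_inj; rewrite enum_rankK_in.
Qed.
Definition perm_repr := MxRepresentation perm_repr_mx_repr.

Lemma mxtrace_perm_repr x : \tr (perm_repr x) = #|'Fix_(S | to)[x]|%:R.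
Proof.
rewrite /mxtrace /= (eq_bigr (fun i => (to (enum_val i) x == enum_val i)%:R));
  last by move=> i _; rewrite mxE.
rewrite -(big_enum_val (fun y => (to y x == y)%:R)) -natr_sum -sum1_card.
rewrite big_mkcond [in RHS]big_mkcond; congr _%:R; apply: eq_bigr => y _.
by rewrite in_setI; case: (y \in S); rewrite //= (sameP afix1P eqP); case: (_ == _).
Qed.
End PermRepr.

(** * Inner products of characters *)

Lemma mxtrace_idempotent (K : fieldType) n (P : 'M[K]_n) :
  P *m P = P -> \tr P = (\rank P)%:R.
Proof.
move=> PP; have CR := mulmx_base P.
have RC : row_base P *m col_base P = 1%:M.
  apply: (row_free_inj (row_base_free P)).
  have/row_fullP[D DC] : row_full (col_base P) by exact: col_base_full.
  have DP : D *m P = row_base P.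
    by have := congr1 (mulmx D) CR; rewrite mulmxA DC mul1mx.
  by rewrite mul1mx -mulmxA CR -DP -mulmxA PP.
transitivity (\tr (col_base P *m row_base P)); first by rewrite CR.
by rewrite mxtrace_mulC RC mxtrace1.
Qed.

Lemma mxtrace_lin_mul (K : fieldType) m n (A : 'M[K]_m) (B : 'M[K]_n) :
  \tr (lin_mx (mulmxr B \o mulmx A)) = \tr A * \tr B.
Proof.
rewrite /mxtrace big_distrlr /= (reindex _ (curry_mxvec_bij _ _)) /=.
rewrite pair_bigA; apply: eq_bigr => [[i j]] /= _.
rewrite mxE /= vec_mx_delta mxvecE mxE (bigD1 j) //= big1 ?addr0.
  rewrite mxE (bigD1 i) //= big1 ?addr0; first by rewrite mxE !eqxx mulr1.
  by move=> k ki; rewrite mxE (negPf ki) mulr0.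
move=> k kj; rewrite mxE big1 ?mul0r // => k' _.
by rewrite mxE (negPf kj) andbF mulr0.
Qed.

Section Orthogonality.
Variables (K : fieldType) (gT : finGroupType) (G : {group gT}).
Hypothesis K'G : [pchar K]^'.-group G.

Let nzG : #|G|%:R != 0 :> K.
Proof. by move: K'G; rewrite /pgroup pcharf'_nat. Qed.

Variables (m n : nat).
Variables (r1 : mx_representation K G m) (r2 : mx_representation K G n).

(** The average over G acting on 'M_(m, n) by X |-> r1 x^-1 X r2 x, as an
    operator on the vectors mxvec X: it projects onto the G-homomorphisms. *)
Definition hom_proj : 'M[K]_(m * n) :=
  #|G|%:R^-1 *: \sum_(x in G) lin_mx (mulmxr (r2 x) \o mulmx (r1 x^-1%g)).

Lemma hom_projE (X : 'M_(m, n)) : mxvec X *m hom_proj =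
  mxvec (#|G|%:R^-1 *: \sum_(x in G) r1 x^-1%g *m X *m r2 x).
Proof.
rewrite -scalemxAr mulmx_sumr linearZ; congr (_ *: _); rewrite raddf_sum /=.
by apply: eq_bigr => x _; rewrite mul_vec_lin.
Qed.

Lemma hom_projP (X : 'M_(m, n)) :
  reflect {in G, forall x, r1 x *m X = X *m r2 x} (mxvec X <= hom_proj)%MS.
Proof.
apply: (iffP submxP) => [[w] | comX]; last first.
  exists (mxvec X); rewrite hom_projE (eq_bigr (fun=> X)).
    by rewrite sumr_const -scaler_nat scalerA mulVf // scale1r.
  by move=> x Gx; rewrite -mulmxA -comX // mulmxA -repr_mxM ?groupV // mulVg
     repr_mx1 mul1mx.
rewrite -[w]vec_mxK hom_projE => /(can_inj mxvecK)-> x Gx.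
rewrite -scalemxAl -scalemxAr mulmx_suml mulmx_sumr; congr (_ *: _).
rewrite [RHS](reindex_inj (mulIg x^-1)%g) /=.
apply: eq_big => [g|g Gg]; first by rewrite groupMr ?groupV.
have Ggx : (g * x^-1)%g \in G by rewrite groupM ?groupV.
rewrite -[in RHS]mulmxA -repr_mxM // mulgKV invMg invgK.
by rewrite (repr_mxM _ Gx) ?groupV // !mulmxA.
Qed.

Lemma hom_proj_idem : hom_proj *m hom_proj = hom_proj.
Proof.
apply/row_matrixP=> i; rewrite row_mul -[row i hom_proj]vec_mxK hom_projE.
set X := vec_mx _; have /hom_projP cX : (mxvec X <= hom_proj)%MS.
  by rewrite vec_mxK row_sub.
rewrite (eq_bigr (fun=> X)).
  by rewrite sumr_const -scaler_nat scalerA mulVf // scale1r.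
by move=> x Gx; rewrite -mulmxA -cX // mulmxA -repr_mxM ?groupV // mulVg
     repr_mx1 mul1mx.
Qed.

(** The trace of a projection is its rank, here the dimension of the space of
    homomorphisms.  In characteristic 0 this is the orthogonality relation in
    the form that is meaningful over a field that need not split. *)
Lemma sum_mxtrace_hom :
  \sum_(x in G) \tr (r1 x^-1%g) * \tr (r2 x) = (#|G| * \rank hom_proj)%:R.
Proof.
rewrite natrM -(mxtrace_idempotent hom_proj_idem) mxtraceZ mulrA divff // mul1r.
by rewrite raddf_sum /=; apply: eq_bigr => x _; rewrite mxtrace_lin_mul.
Qed.
End Orthogonality.

Lemma rank_hom_proj_cent (K : fieldType) (gT : finGroupType) (G : {group gT}) n
    (rG : mx_representation K G n) : [pchar K]^'.-group G ->
  \rank (hom_proj rG rG) = \rank 'C(enveloping_algebra_mx rG).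
Proof.
move=> K'G; suff -> : (hom_proj rG rG :=: 'C(enveloping_algebra_mx rG))%MS by [].
apply/eqmxP; apply/rV_eqP => u; rewrite -[u]vec_mxK memmx_cent_envelop.
by apply/hom_projP/centgmxP => // cX x Gx; rewrite cX.
Qed.

(** * Division algebras acting on representations *)

Lemma socle_decomposition (K : fieldType) (gT : finGroupType) (G : {group gT}) n
    (rG : mx_representation K G n) (sG : socleType rG) (W : sG) :
  exists (I : finType) (U : I -> 'M_n),
    [/\ forall i, mx_iso rG (socle_base W) (U i), (\sum_i U i :=: W)%MS,
        mxdirect (\sum_i U i) & #|I| = socle_mult W].
Proof.
have simW := socle_simple W.
have [I U /= simU defU dxU] := component_mx_semisimple simW.
have isoU i : mx_iso rG (socle_base W) (U i).
  by apply: component_mx_iso => //; rewrite -defU (sumsmx_sup i).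
exists I, U; split=> //.
have rkW : \rank W = (#|I| * \rank (socle_base W))%N.
  rewrite -defU (mxdirectP dxU) /= -sum_nat_const; apply: eq_bigr => i _.
  by rewrite (mxrank_iso (isoU i)).
by rewrite /socle_mult rkW mulnK // lt0n mxrank_eq0; case: simW.
Qed.

(** A division algebra D of dimension d acts on the right of a module; delta u
    is the action of the element with coordinates u. *)
Section DivisionAction.
Variables (K : fieldType) (d N : nat) (delta : 'rV[K]_d -> 'M[K]_N).
Hypotheses (delta_linear : linear delta) (d_gt0 : (0 < d)%N).
Hypothesis delta_unit : forall u, u != 0 -> delta u \in unitmx.
Hypothesis delta_mul : forall u v, exists w, delta u *m delta v = delta w.

HB.instance Definition _ := GRing.isLinear.Build K _ _ _ delta delta_linear.

Definition orbit_mx (x : 'rV[K]_N) : 'M[K]_(d, N) := lin1_mx (mulmx x \o delta).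

Lemma orbit_mxE x u : u *m orbit_mx x = x *m delta u.
Proof. by rewrite mul_rV_lin1. Qed.

Lemma rank_orbit_mx x : x != 0 -> \rank (orbit_mx x) = d.
Proof.
move=> nzx; apply/eqP; rewrite -[_ == _]/(row_free _).
apply: contraLR nzx; rewrite -kermx_eq0 => /rowV0Pn[u /sub_kermxP].
rewrite orbit_mxE => xu0 nzu; rewrite negbK.
by rewrite -[x](mulmxK (delta_unit nzu)) xu0 mul0mx.
Qed.

(** A stable space is a vector space over the division algebra.  The proof
    enlarges a stable subspace Y one orbit x.D at a time; the orbit meets Y in
    0 because each nonzero delta u maps Y onto Y. *)
Lemma dvdn_rank_stable k (X : 'M[K]_(k, N)) :
  (forall u, X *m delta u <= X)%MS -> (d %| \rank X)%N.
Proof.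
move=> stX; suff main c (Y : 'M_N) : (\rank X - \rank Y < c)%N -> (Y <= X)%MS ->
    (forall u, Y *m delta u <= Y)%MS -> (d %| \rank Y)%N -> (d %| \rank X)%N.
  apply: (main _.+1 0) => //; first by rewrite sub0mx.
    by move=> u; rewrite mul0mx.
  by rewrite mxrank0.
elim: c Y => // c IH Y ltc sYX stY dY.
have [sXY|/row_subPn[i nYx]] := boolP (X <= Y)%MS.
  suff -> : \rank X = \rank Y by [].
  by apply/eqP; rewrite eqn_leq !mxrankS.
set x := row i X in nYx; have Xx : (x <= X)%MS by apply: row_sub.
have nzx : x != 0 by apply: contraNneq nYx => ->; rewrite sub0mx.
have cap0 : (Y :&: orbit_mx x = 0)%MS.
  apply/eqP/rowV0P => v; rewrite sub_capmx => /andP[Yv /submxP[u vE]].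
  have [u0|nzu] := eqVneq u 0; first by rewrite vE u0 mul0mx.
  case/negP: nYx; rewrite -(submxMfree _ _ (_ : row_free (delta u))); last first.
    by rewrite row_free_unit delta_unit.
  rewrite -orbit_mxE -vE; apply: submx_trans Yv _.
  rewrite -(geq_leqif (mxrank_leqif_sup (stY u))).
  by rewrite mxrankMfree // row_free_unit delta_unit.
have rkYx : \rank (Y + orbit_mx x)%MS = (\rank Y + d)%N.
  by rewrite mxrank_disjoint_sum // rank_orbit_mx.
have sub : (Y + orbit_mx x <= X)%MS.
  rewrite addsmx_sub sYX; apply/rV_subP=> v /submxP[u ->].
  by rewrite orbit_mxE (submx_trans (submxMr _ Xx)).
apply: (IH (Y + orbit_mx x)%MS) => //.
- have := mxrankS sub; rewrite rkYx => le.
  rewrite (leq_trans _ (ltc : _ <= c)%N) // ltn_sub2l //; last first.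
    by rewrite -addn1 leq_add2l.
  by apply: leq_trans le; rewrite -addn1 leq_add2l.
- move=> u; rewrite addsmxMr addsmx_sub (submx_trans (stY u) (addsmxSl _ _)) /=.
  apply: submx_trans (addsmxSr _ _); apply/rV_subP=> v /submxP[w ->].
  rewrite mulmxA orbit_mxE -mulmxA; have [w' ->] := delta_mul w u.
  by rewrite -orbit_mxE submxMl.
by rewrite rkYx dvdn_addl.
Qed.

Variables (gT : finGroupType) (H : {group gT}) (rH : mx_representation K H N).
Hypothesis delta_cent : forall u, centgmx rH (delta u).
Hypothesis splitH : group_splitting_field K H.

(** As the socle base S is absolutely irreducible, some combination e of group
    elements acts on S as an elementary matrix, hence with rank 1 on each
    module isomorphic to S.  The rank of e on the component W is therefore the
    multiplicity of S, and W e is stable under the division algebra. *)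
Lemma dvdn_socle_mult (sH : socleType rH) (W : sH) : (d %| socle_mult W)%N.
Proof.
set S := socle_base W; have simS : mxsimple rH S := socle_simple W.
have /mx_abs_irrP[r_gt0 [a_ aE]] := splitH (socle_irr W).
set r := \rank S in r_gt0 aE *.
pose i0 := Ordinal r_gt0; pose a x := a_ x (delta_mx i0 i0).
pose e := \sum_(x in H) a x *: rH x.
have homSe f : (S <= dom_hom_mx rH f)%MS -> S *m e *m f = S *m f *m e.
  move=> /hom_mxP homf; rewrite /e !mulmx_sumr mulmx_suml.
  by apply: eq_bigr => x Hx; rewrite -!scalemxAr -scalemxAl homf.
have rkSe : \rank (S *m e) = 1%N.
  rewrite -(eqmxMr e (val_submod1 S)).
  have -> : val_submod (1%:M : 'M_(\rank S)) *m e =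
      val_submod (delta_mx i0 i0 : 'M_(\rank S)).
    rewrite [in RHS](aE (delta_mx i0 i0)) mulmx_sumr.
    rewrite [RHS]val_submodE mulmx_suml.
    apply: eq_bigr => x Hx; rewrite -scalemxAr -[in RHS]scalemxAl; congr (_ *: _).
    by rewrite -[RHS]val_submodE -(val_submodJ (socle_module W)) // mul1mx.
  by rewrite mxrankMfree ?row_base_free // mxrank_delta.
have [I [U [isoU defU dxU <-]]] := socle_decomposition W.
have rkUe i : \rank (U i *m e) = 1%N.
  have [f uf homf defUi] := isoU i.
  by rewrite -(eqmxMr e defUi) -homSe // mxrankMfree // row_free_unit.
have sUe i : (U i *m e <= U i)%MS.
  rewrite /e mulmx_sumr; apply: summx_sub => x Hx; rewrite -scalemxAr scalemx_sub //.
  by apply: (mxmoduleP (mx_iso_module (isoU i) (mxsimple_module simS))).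
have rkWe : \rank (W *m e) = #|I|.
  rewrite -(eqmxMr e defU) sumsmxMr.
  rewrite (mxdirectP (_ : mxdirect (\sum_i U i *m e))) /=.
    by rewrite (eq_bigr (fun=> 1%N)) // sum1_card.
  apply/mxdirect_sumsP=> i _; apply/eqP; rewrite -submx0.
  have sUe' : (\sum_(j | j != i) U j *m e <= \sum_(j | j != i) U j)%MS.
    by apply/sumsmx_subP=> j ji; rewrite (sumsmx_sup j).
  by have := capmxS (sUe i) sUe'; rewrite (mxdirect_sumsP dxU i isT).
rewrite -rkWe; apply: dvdn_rank_stable => u.
have ce : e *m delta u = delta u *m e.
  rewrite /e mulmx_suml mulmx_sumr; apply: eq_bigr => x Hx.
  by rewrite -scalemxAl -scalemxAr (centgmxP (delta_cent u)).
rewrite -mulmxA ce mulmxA; apply: submxMr.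
apply: hom_component_mx => //; exact: centgmx_hom.
Qed.
End DivisionAction.

Section Tensor.
Variables (K : fieldType) (m n : nat).
Implicit Types (A : 'M[K]_m) (B : 'M[K]_n).

(** The Kronecker product; since matrices act on row vectors, the transpose is
    what makes it multiplicative. *)
Definition tensor_mx A B : 'M[K]_(m * n) := lin_mx (mulmxr B \o mulmx A^T).

Lemma mul_mxvec_tensor_mx A B X : mxvec X *m tensor_mx A B = mxvec (A^T *m X *m B).
Proof. by rewrite mul_vec_lin. Qed.

Lemma tensor_mxM A A' B B' :
  tensor_mx A B *m tensor_mx A' B' = tensor_mx (A *m A') (B *m B').
Proof.
apply/row_matrixP=> i; rewrite !rowE mulmxA -[delta_mx 0 i]vec_mxK !mul_mxvec_tensor_mx.
by rewrite trmx_mul !mulmxA.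
Qed.

Lemma tensor_mx1 : tensor_mx 1%:M 1%:M = 1%:M.
Proof.
apply/row_matrixP=> i; rewrite !rowE -[delta_mx 0 i]vec_mxK !mul_mxvec_tensor_mx.
by rewrite trmx1 mul1mx !mulmx1.
Qed.

Lemma mxtrace_tensor_mx A B : \tr (tensor_mx A B) = \tr A * \tr B.
Proof. by rewrite mxtrace_lin_mul mxtrace_tr. Qed.

Lemma tensor_mx_linear B : linear (tensor_mx^~ B).
Proof.
move=> c A A'; apply/row_matrixP=> i; rewrite linearP /= !rowE.
rewrite -[delta_mx 0 i]vec_mxK !mul_mxvec_tensor_mx -linearP; congr mxvec.
by rewrite linearP /= !mulmxDl -!scalemxAl.
Qed.

Variables (gT : finGroupType) (G : {group gT}).
Variables (r1 : mx_representation K G m) (r2 : mx_representation K G n).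

Lemma tensor_mx_repr : mx_repr G (fun x => tensor_mx (r1 x) (r2 x)).
Proof.
split=> [|x y Gx Gy]; first by rewrite !repr_mx1 tensor_mx1.
by rewrite !repr_mxM // tensor_mxM.
Qed.
Definition tensor_repr := MxRepresentation tensor_mx_repr.
End Tensor.

Definition division_action (K : fieldType) d N (delta : 'rV[K]_d -> 'M[K]_N) :=
  [/\ linear delta, forall u, u != 0 -> delta u \in unitmx
    & forall u v, exists w, delta u *m delta v = delta w].

Lemma division_action_tensor (K : fieldType) d m n (delta : 'rV[K]_d -> 'M[K]_m) :
  division_action delta -> division_action (fun u => tensor_mx (delta u) (1%:M : 'M_n)).
Proof.
case=> lin unit mul; split=> [c u v|u nzu|u v].
- by rewrite lin tensor_mx_linear.
- suff /mulmx1_unit[] : tensor_mx (delta u) (1%:M : 'M_n) *m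
      tensor_mx (invmx (delta u)) 1%:M = 1%:M by [].
  by rewrite tensor_mxM mulmxV ?unit // mulmx1 tensor_mx1.
by have [w uv] := mul u v; exists w; rewrite tensor_mxM uv mulmx1.
Qed.

Lemma mxtrace_socle_sum (K : fieldType) (gT : finGroupType) (G : {group gT}) n
    (rG : mx_representation K G n) (sG : socleType rG) x :
  [pchar K]^'.-group G -> x \in G ->
  \tr (rG x) = \sum_(W : sG) \tr (socle_repr W x) *+ socle_mult W.
Proof.
move=> K'G Gx; rewrite -mxtrace_Socle // mxtrace_submod1 //.
by rewrite reducible_Socle1 //; apply: mx_Maschke_pchar.
Qed.

(** Both characters are d times characters of H. *)
Lemma division_action_char_dvd (K : fieldType) (gT : finGroupType)
    (H : {group gT}) d m n (r1 : mx_representation K H m)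
    (r2 : mx_representation K H n) delta1 delta2 :
  [pchar K]^'.-group H -> group_splitting_field K H -> (0 < d)%N ->
  @division_action K d m delta1 -> (forall u, centgmx r1 (delta1 u)) ->
  @division_action K d n delta2 -> (forall u, centgmx r2 (delta2 u)) ->
  exists k, \sum_(x in H) \tr (r1 x^-1%g) * \tr (r2 x)
    = (#|H| * (d * d * k))%:R.
Proof.
move=> K'H splitH d_gt0 [lin1 unit1 mul1] cent1 [lin2 unit2 mul2] cent2.
apply/asboolP; apply: (socle_exists r1) => s1; apply: (socle_exists r2) => s2.
apply/asboolP.
have dv1 (W : s1) := dvdn_socle_mult lin1 d_gt0 unit1 mul1 cent1 splitH W.
have dv2 (W : s2) := dvdn_socle_mult lin2 d_gt0 unit2 mul2 cent2 splitH W.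
pose rk (W1 : s1) (W2 : s2) := \rank (hom_proj (socle_repr W1) (socle_repr W2)).
exists (\sum_(W1 : s1) \sum_(W2 : s2)
   rk W1 W2 * (socle_mult W1 %/ d * (socle_mult W2 %/ d)))%N.
transitivity (\sum_(x in H) \sum_(W1 : s1) \sum_(W2 : s2)
    (\tr (socle_repr W1 x^-1%g) * \tr (socle_repr W2 x))
      *+ (socle_mult W1 * socle_mult W2)).
  apply: eq_bigr => x Hx; rewrite (mxtrace_socle_sum s1) ?groupV //.
  rewrite (mxtrace_socle_sum s2) // big_distrlr /=; apply: eq_bigr => W1 _.
  by apply: eq_bigr => W2 _; rewrite mulrnAl mulrnAr -mulrnA mulnC.
rewrite exchange_big /= !big_distrr /= natr_sum; apply: eq_bigr => W1 _.
rewrite exchange_big /= !big_distrr /= natr_sum; apply: eq_bigr => W2 _.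
rewrite sumrMnl sum_mxtrace_hom // -/(rk _ _) -mulrnA; congr _%:R.
rewrite -{1}(divnK (dv1 W1)) -{1}(divnK (dv2 W2)).
by rewrite -mulnA; congr (_ * _)%N; rewrite mulnACA mulnA mulnC.
Qed.

(** * Brauer's theorem on splitting fields *)

Lemma irr_division_action (K : fieldType) (gT : finGroupType)
    (G : {group gT}) n (rG : mx_representation K G n) :
  mx_irreducible rG ->
  exists delta : 'rV_(\rank 'C(enveloping_algebra_mx rG)%MS) -> 'M_n,
    division_action delta /\ forall u, centgmx rG (delta u).
Proof.
move=> irrG; set E := enveloping_algebra_mx rG.
pose delta (u : 'rV_(\rank 'C(E)%MS)) : 'M_n := vec_mx (u *m row_base 'C(E)%MS).
have cent u : centgmx rG (delta u).
  by rewrite -memmx_cent_envelop vec_mxK (submx_trans (submxMl _ _)) ?eq_row_base.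
exists delta; split=> //; split=> [c u v|u nzu|u v].
- by rewrite /delta mulmxDl -scalemxAl linearP.
- apply: (mx_Schur irrG) => //; rewrite /delta.
  apply: contraNneq nzu => /(congr1 mxvec); rewrite vec_mxK linear0 => u0.
  by rewrite -(inj_eq (row_free_inj (row_base_free 'C(E)%MS))) u0 mul0mx.
have cuv : centgmx rG (delta u *m delta v).
  apply/centgmxP=> x Gx.
  by rewrite -mulmxA (centgmxP (cent v)) // mulmxA (centgmxP (cent u)) // mulmxA.
have : (mxvec (delta u *m delta v) <= row_base 'C(E)%MS)%MS.
  by rewrite eq_row_base memmx_cent_envelop.
by case/submxP=> w uvw; exists w; rewrite /delta -uvw mxvecK.
Qed.

Lemma mxtrace_reprJ (K : fieldType) (gT : finGroupType) (G : {group gT}) n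
    (rG : mx_representation K G n) x y :
  x \in G -> y \in G -> \tr (rG (x ^ y)%g) = \tr (rG x).
Proof.
move=> Gx Gy; rewrite conjgE !repr_mxM ?groupM ?groupV // mxtrace_mulC.
by rewrite -mulmxA -repr_mxM ?groupV // mulgV repr_mx1 mulmx1.
Qed.

Section InductionStep.
Variables (K : fieldType) (gT : finGroupType) (G : {group gT}) (n : nat).
Variable rG : mx_representation K G n.
Hypotheses (K0 : [pchar K] =i pred0) (irrG : mx_irreducible rG).
Hypothesis splitS : forall H : {group gT}, H \proper G ->
  group_splitting_field K H.
Hypothesis ncnG : ~ cyclic_by_nilpotent G.

Let d := \rank 'C(enveloping_algebra_mx rG)%MS.

Lemma pchar0_pgroup (H : {group gT}) : [pchar K]^'.-group H.
Proof.
by apply/pgroupP=> p _ _; rewrite inE /= K0.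
Qed.

(** With chi the character of rG, psi that of rM and d the dimension of the
    endomorphism algebra, the inner product of f chi psi with chi is required
    to be an integer multiple of d ^ 2.  Letting rM vary makes the condition
    stable under multiplication of f by permutation characters. *)
Definition divisible_weight (f : gT -> int) :=
  forall N (rM : mx_representation K G N), exists k : int,
  \sum_(x in G) (f x)%:~R * (\tr (rG x^-1%g) * \tr (rG x) * \tr (rM x))
     = ((#|G| * (d * d))%:Z * k)%:~R.

(** Stability under products lets an identity between products of weights be
    exploited without describing the ring that they generate. *)
Definition ideal_weight f :=
  divisible_weight f /\
  forall g, divisible_weight g -> divisible_weight (fun x => g x * f x).

Lemma divisible_weightB f g : divisible_weight f -> divisible_weight g ->
  divisible_weight (fun x => f x - g x).
Proof.
move=> df dg N rM; have [[k kE] [j jE]] := (df N rM, dg N rM).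
exists (k - j); rewrite mulrBr intrB -kE -jE -sumrB.
by apply: eq_bigr => x _; rewrite intrB mulrBl.
Qed.

Lemma divisible_weightZ c f : divisible_weight f ->
  divisible_weight (fun x => c * f x).
Proof.
move=> df N rM; have [k kE] := df N rM.
exists (c * k); rewrite mulrCA intrM -kE mulr_sumr.
by apply: eq_bigr => x _; rewrite intrM mulrA.
Qed.

Lemma eq_divisible_weight f g : f =1 g -> divisible_weight f -> divisible_weight g.
Proof. by move=> /funext->. Qed.

Lemma ideal_weightB f g : ideal_weight f -> ideal_weight g ->
  ideal_weight (fun x => f x - g x).
Proof.
case=> df mf [dg mg]; split=> [|h dh]; first exact: divisible_weightB.
apply: eq_divisible_weight (divisible_weightB (mf h dh) (mg h dh)) => x.
by rewrite mulrBr.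
Qed.

Lemma ideal_weightZ c f : ideal_weight f -> ideal_weight (fun x => c * f x).
Proof.
case=> df mf; split=> [|h dh]; first exact: divisible_weightZ.
by apply: eq_divisible_weight (divisible_weightZ c (mf h dh)) => x; rewrite mulrCA.
Qed.

Lemma rank_cent_gt0 : (0 < d)%N.
Proof.
rewrite lt0n mxrank_eq0; apply/eqP => C0.
have : centgmx rG 1%:M by apply/centgmxP=> x _; rewrite mulmx1 mul1mx.
rewrite -memmx_cent_envelop C0 submx0 mxvec_eq0 -mxrank_eq0 mxrank1.
by have [n_gt0 _] := (mx_irrP _).1 irrG; rewrite eqn0Ngt n_gt0.
Qed.

(** Frobenius reciprocity turns the weighted sum over G into the inner product
    over H of the characters of rG and of its tensor product with rM, both
    acted upon by the endomorphism algebra of rG.  Multiplication by the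
    permutation character amounts to tensoring rM with the permutation
    representation. *)
Lemma ideal_weight_perm_char (H : {group gT}) : H \proper G ->
  ideal_weight (fun x => (perm_char H G x)%:Z).
Proof.
move=> prH; have sHG := proper_sub prH; have d_gt0 := rank_cent_gt0.
split=> [N rM|f df N rM].
  have [delta [act cent]] := irr_division_action irrG.
  pose r1 := subg_repr rG sHG; pose r2 := subg_repr (tensor_repr rG rM) sHG.
  have cent1 u : centgmx r1 (delta u).
    by apply/centgmxP=> x Hx; apply: (centgmxP (cent u)); apply: (subsetP sHG).
  have cent2 u : centgmx r2 (tensor_mx (delta u) 1%:M).
    apply/centgmxP=> x Hx; rewrite /= !tensor_mxM mulmx1 mul1mx.
    by rewrite (centgmxP (cent u)) // (subsetP sHG).
  have [k kE] := division_action_char_dvd (pchar0_pgroup H) (splitS prH)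
    d_gt0 act cent1 (division_action_tensor N act) cent2.
  exists k%:Z; pose F x := \tr (rG x^-1%g) * \tr (rG x) * \tr (rM x).
  rewrite (eq_bigr (fun x => (perm_char H G x)%:R * F x)) //.
  rewrite sum_perm_char //; last first.
    by move=> x y Gx Gy; rewrite /F -conjVg !mxtrace_reprJ ?groupV.
  rewrite (eq_bigr (fun x => \tr (r1 x^-1%g) * \tr (r2 x))) => [|x _].
    rewrite kE -mulrnA -PoszM -pmulrn; congr _%:R.
    by rewrite mulnAC Lagrange // mulnA.
  by rewrite /F /= mxtrace_tensor_mx mulrA.
pose rP := perm_repr K (acts_rcosets_Rs G H).
have [k kE] := df _ (tensor_repr rM rP); exists k; rewrite -kE.
apply: eq_bigr => x Gx; rewrite mxtrace_tensor_mx mxtrace_perm_repr -/(perm_char H G x).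
by rewrite intrM -!mulrA; congr (_ * _); rewrite mulrC !mulrA.
Qed.

(** The values at x of the ideal weights form an ideal of the integers; for
    each prime p it contains a number prime to p. *)
Lemma ideal_weight_one x : x \in G ->
  exists2 f, ideal_weight f & f x = 1.
Proof.
move=> Gx; pose P m := `[< (0 < m)%N /\ exists2 f, ideal_weight f & f x = m%:Z >].
have nonmult p : prime p -> exists2 f, ideal_weight f & ~~ (p %| f x)%Z.
  move=> p_pr; have [H prH npH] := not_cyclic_by_nilpotent_perm_char p_pr Gx ncnG.
  by exists (fun x => (perm_char H G x)%:Z); first exact: ideal_weight_perm_char.
have exP : exists m, P m.
  have [f idf] := nonmult 2%N isT; case fx: (f x) => [m|m].
    move=> odd_m; exists m; apply/asboolP; split; last by exists f.
    by case: m odd_m {fx}.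
  move=> _; exists m.+1; apply/asboolP; split=> //; exists (fun y => (-1) * f y).
    exact: ideal_weightZ.
  by rewrite fx NegzE mulN1r opprK.
case: (ex_minnP exP) => m /asboolP[m_gt0 [f idf fx]] minm.
have dvm g : ideal_weight g -> (m %| g x)%Z.
  move=> idg; apply: contraT => ndv.
  have nz_m : m%:Z != 0 by rewrite -lt0n.
  have modE : (g x %% m)%Z = `|(g x %% m)%Z|%N by rewrite gez0_abs ?modz_ge0.
  have : P `|(g x %% m)%Z|%N.
    apply/asboolP; split.
      by rewrite absz_gt0; apply: contra ndv => /eqP/dvdz_mod0P.
    exists (fun y => g y - (g x %/ m)%Z * f y).
      by apply: ideal_weightB => //; apply: ideal_weightZ.
    by rewrite fx -modE {1}(divz_eq (g x) m) addrAC subrr add0r.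
  by move/minm; rewrite -lez_nat -modE leNgt ltz_pmod.
have m1 : m = 1%N.
  apply/eqP; apply: contraT => nm1.
  have /pdivP[p p_pr pm] : (1 < m)%N by rewrite ltn_neqAle eq_sym nm1.
  have [g idg] := nonmult p p_pr; rewrite (dvdz_trans _ (dvm g idg)) //.
by exists f; rewrite // fx m1.
Qed.

(** Banaschewski's argument: the product of the 1 - f_x, with f_x of value 1 at
    x, vanishes on G.  The function h is 1 minus a partial product. *)
Lemma divisible_weight_one : divisible_weight (fun=> 1).
Proof.
have [h dh hE] : exists2 h, divisible_weight h & {in enum G, forall x, h x = 1}.
  have: {subset enum G <= G} by move=> x; rewrite mem_enum.
  elim: (enum G) => [_|x s IH sG].
    exists (fun=> 0) => // N rM; exists 0; rewrite big1 ?mulr0 // => y _.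
    by rewrite mul0r.
  have [|h dh hs] := IH; first by move=> y ys; apply: sG; rewrite inE ys orbT.
  have [|f [df mf] fx] := @ideal_weight_one x; first by rewrite sG ?mem_head.
  exists (fun y => h y - (h y * f y - f y)).
    by apply: divisible_weightB => //; apply: divisible_weightB => //; apply: mf.
  move=> y; rewrite inE => /predU1P[->|ys].
    by rewrite fx mulr1 opprB addrC subrK.
  by rewrite hs // mul1r subrr subr0.
move=> N rM; have [k kE] := dh N rM; exists k; rewrite -kE.
by apply: eq_bigr => x Gx; rewrite hE // mem_enum.
Qed.

(** For the weight 1 and the trivial rM the weighted sum is #|G| * d. *)
Lemma rank_cent_eq1 : d = 1%N.
Proof.
have unit_repr : mx_repr G (fun=> 1%:M : 'M[K]_1).
  by split=> // x y _ _; rewrite mulmx1.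
have [k] := divisible_weight_one (MxRepresentation unit_repr).
rewrite (eq_bigr (fun x => \tr (rG x^-1%g) * \tr (rG x))) => [|x _]; last first.
  by rewrite mul1r mxtrace1 mulr1.
rewrite (sum_mxtrace_hom (pchar0_pgroup G)) rank_hom_proj_cent ?pchar0_pgroup //.
rewrite -/d pmulrn.
have inj0 (a : int) : a%:~R = 0 :> K -> a = 0.
  case: a => [a|a]; rewrite ?NegzE ?mulrNz => /eqP.
    by rewrite -pmulrn ((pcharf0P K).1 K0) => /eqP->.
  by rewrite oppr_eq0 -pmulrn ((pcharf0P K).1 K0).
move/eqP; rewrite -subr_eq0 -intrB => /eqP/inj0/eqP; rewrite subr_eq0.
move/eqP/(congr1 absz)/eqP; rewrite abszM !absz_nat -mulnA eqn_pmul2l //.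
rewrite -mulnA -{1}[d]muln1 eqn_pmul2l ?rank_cent_gt0 // eq_sym muln_eq1.
by case/andP=> /eqP.
Qed.
End InductionStep.

Lemma pchar0_splitting (K : fieldType) (gT : finGroupType) (G : {group gT}) :
  [pchar K] =i pred0 -> (exists z : K, (exponent G).-primitive_root z) ->
  group_splitting_field K G.
Proof.
move=> K0; have [N] := ubnP #|G|; elim: N => // N IH in G *.
rewrite ltnS => leGN ez.
have [cnG|ncnG] := pselect (cyclic_by_nilpotent G).
  exact: cyclic_by_nilpotent_splitting.
move=> n rG irrG; apply: cent_mx_scalar_abs_irr => //.
rewrite (rank_cent_eq1 K0 irrG _ ncnG) // => H prH.
apply: IH; first exact: leq_trans (proper_card prH) leGN.
have [z pz] := ez; exists (z ^+ (exponent G %/ exponent H)).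
have dv := exponentS (proper_sub prH); exact: (dvdn_prim_root pz dv).
Qed.

Theorem sufficient_roots_splitting (K : fieldType) (gT : finGroupType)
    (G : {group gT}) :
  [pchar K]^'.-group G -> (exists z : K, (exponent G).-primitive_root z) ->
  group_splitting_field K G.
Proof.
move=> K'G ez; have [[p chp]|nch] := pselect (exists p, p \in [pchar K]).
  by have [z pz] := ez; apply: pchar_splitting chp K'G pz.
apply: pchar0_splitting ez => p; rewrite inE; apply/negP=> chp.
by apply: nch; exists p.
Qed.

Local Close Scope group_scope.

(** * First homology of a group with trivial coefficients *)

Lemma freeg_sumZ (F : fieldType) (X : choiceType) (D : {freeg X / F}) :
  D = \sum_(x <- dom D) coeff x D *: (<< x >> : {freeg X / F}).
Proof.
rewrite -[LHS]freeg_sumE; apply: eq_bigr => x _.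
by apply/eqP/freeg_eqP => y; rewrite coeffZ !coeffU mul1r.
Qed.

Section FiniteHomology.
Variables (F : fieldType) (C2 C1 C0 : lmodType F).
Variables (d2 : {linear C2 -> C1}) (d1 : {linear C1 -> C0}).

(** A generating family of minimal length is a basis. *)
Lemma homology_dim_exists (N : nat) (z : 'I_N -> C1) :
  (forall i, d1 (z i) = 0) ->
  (forall c, d1 c = 0 -> exists (a : 'rV[F]_N) b, c = \sum_i a 0 i *: z i + d2 b) ->
  exists n, homology_dim d2 d1 n.
Proof.
move=> z0 zs.
pose P n := `[< exists2 z : 'I_n -> C1, forall i, d1 (z i) = 0 &
  forall c, d1 c = 0 ->
    exists (a : 'rV[F]_n) b, c = \sum_i a 0 i *: z i + d2 b >].
have exP : exists n, P n by exists N; apply/asboolP; exists z.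
case: (ex_minnP exP) => n /asboolP[{z0 zs N}z z0 zs] minn.
exists n, z => // c c0; have [a [b cE]] := zs c c0.
exists a; split=> [|a' [b' cE']]; first by exists b.
apply: contrapT => ne; have [k nek] : exists k, a 0 k != a' 0 k.
  apply: contrapT => nk; apply: ne; apply/rowP => k; apply/eqP.
  by apply: contrapT => /negP ek; apply: nk; exists k.
case: n z z0 zs minn a a' k cE cE' ne nek => [|n] z z0 zs minn a a' k cE cE' _ nek.
  by case: k nek.
pose e j := a 0 j - a' 0 j; have nze : e k != 0 by rewrite subr_eq0.
have rel : \sum_j e j *: z j = d2 (b' - b).
  rewrite raddfB /= (eq_bigr (fun j => a 0 j *: z j - a' 0 j *: z j)) => [|j _].
    have Ea := canRL (addrK (d2 b)) (esym cE).
    have Ea' := canRL (addrK (d2 b')) (esym cE').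
    by rewrite sumrB Ea Ea' opprB addrC addrA subrK.
  by rewrite scalerBl.
set Y := b' - b in rel; pose q j := (e k)^-1 * e (fintype.lift k j).
have zk : z k = \sum_(j < n) - q j *: z (fintype.lift k j) + d2 ((e k)^-1 *: Y).
  rewrite linearZ -rel (bigD1_ord k) //= scalerDr scalerA mulVf // scale1r.
  rewrite addrCA scaler_sumr -big_split /= big1 ?addr0 // => j _.
  by rewrite scalerA -scalerDl addNr scale0r.
suff /minn : P n by rewrite ltnn.
apply/asboolP; exists (fun j => z (fintype.lift k j)) => // c' /zs[u [w ->]].
exists (\row_j (u 0 (fintype.lift k j) - u 0 k * q j)).
exists (u 0 k *: ((e k)^-1 *: Y) + w).
rewrite (bigD1_ord k) //= [z k]zk scalerDr [d2 (_ + w)]raddfD /=.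
rewrite -[u 0 k *: d2 _]linearZ !addrA; congr (_ + _); rewrite addrAC.
congr (_ + _); rewrite scaler_sumr -big_split; apply: eq_bigr => j _ /=.
by rewrite mxE scalerBl scaleNr scalerN scalerA addrC.
Qed.
End FiniteHomology.

Section H1.
Variables (F : fieldType) (H : groupType).
Local Notation C1 := {freeg H / F}.
Implicit Types (g h : H).

Lemma bar1_0 (c : C1) : bar1 c = 0.
Proof.
rewrite (freeg_sumZ c) linear_sum big1 // => h _.
by rewrite linearZ /= /bar1 liftU subrr !scaler0.
Qed.

Lemma bar2E g h :
  bar2 (<< (g, h) >> : {freeg (H * H)%type / F}) = << h >> - << (g * h)%g >> + << g >>.
Proof. by rewrite /bar2 liftU scale1r. Qed.

Definition boundary (c : C1) := exists b, c = bar2 b.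

Lemma boundaryB c c' : boundary c -> boundary c' -> boundary (c - c').
Proof. by case=> b -> [b' ->]; exists (b - b'); rewrite raddfB. Qed.
Lemma boundaryD c c' : boundary c -> boundary c' -> boundary (c + c').
Proof. by case=> b -> [b' ->]; exists (b + b'); rewrite raddfD. Qed.
Lemma boundaryZ k c : boundary c -> boundary (k *: c).
Proof. by case=> b ->; exists (k *: b); rewrite linearZ. Qed.

Lemma H1_dim_exists (I : finType) (s : I -> H) :
  (forall h, exists a : I -> F,
     boundary (<< h >> - \sum_i a i *: (<< s i >> : C1))) ->
  exists n, H1_dim F H n.
Proof.
move=> span; pose z (k : 'I_#|I|) : C1 := << s (enum_val k) >>.
apply: (@homology_dim_exists _ _ _ _ _ _ _ z) => [i|c _]; first exact: bar1_0.
suff [a bc] : exists a : I -> F, boundary (c - \sum_i a i *: (<< s i >> : C1)).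
  case: bc => b E; exists (\row_k a (enum_val k)), b.
  rewrite -[X in _ + X]E (big_enum_val (fun i => a i *: (<< s i >> : C1))) /=.
  rewrite (eq_bigr (fun k => a (enum_val k) *: z k)) => [|k _]; last by rewrite mxE.
  by rewrite addrC subrK.
rewrite (freeg_sumZ c); elim: (dom c) => [|h t [a IH]].
  exists (fun=> 0); exists 0; rewrite raddf0 big_nil big1 ?subr0 // => i _.
  by rewrite scale0r.
have [a' ba'] := span h; exists (fun i => coeff h c * a' i + a i).
have := boundaryD (boundaryZ (coeff h c) ba') IH.
rewrite big_cons scalerBr addrACA -opprD; congr (boundary (_ - _)).
rewrite scaler_sumr -big_split; apply: eq_bigr => i _.
by rewrite scalerDl scalerA.
Qed.
End H1.

(** The coordinates of the classes of the elements of H in a basis of the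
    first homology group form a basis of the homomorphisms from H to F. *)
Lemma H1_dim_dual (F : fieldType) (H : groupType) n : H1_dim F H n ->
  exists a : H -> 'rV[F]_n,
  [/\ forall g h, a (g * h)%g = a g + a h,
      forall c : 'cV_n, (forall h, a h *m c = 0) -> c = 0 &
      forall f : H -> F, (forall g h, f (g * h)%g = f g + f h) ->
        exists c : 'cV_n, forall h, f h = (a h *m c) 0 0].
Proof.
case=> z _ zP; pose rep c (a : 'rV[F]_n) := exists b, c = \sum_i a 0 i *: z i + bar2 b.
have zE (c : {freeg H / F}) : exists a, rep c a /\ forall a', rep c a' -> a = a'.
  by have [a [? ?]] := zP c (bar1_0 c); exists a.
pose al c := sval (cid (zE c)).
have alP c : rep c (al c) by have [] := svalP (cid (zE c)).
have alU c a : rep c a -> al c = a by move=> ra; have [_] := svalP (cid (zE c)); apply.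
have al_linear : linear al.
  move=> k c c'; apply: alU; case: (alP c) (alP c') => b bE [b' b'E].
  exists (k *: b + b'); rewrite {1}bE {1}b'E linearP scalerDr /= addrACA; congr (_ + _).
  rewrite scaler_sumr -big_split; apply: eq_bigr => i _.
  by rewrite !mxE scalerDl scalerA.
pose L : {linear {freeg H / F} -> 'rV[F]_n} :=
  HB.pack al (GRing.isLinear.Build _ _ _ _ al al_linear).
have LB b : L (bar2 b) = 0.
  apply: alU; exists b; rewrite big1 ?add0r // => i _.
  by rewrite mxE scale0r.
have Lz i : L (z i) = delta_mx 0 i.
  apply: alU; exists 0; rewrite raddf0 addr0 (bigD1 i) //= mxE !eqxx scale1r.
  by rewrite big1 ?addr0 // => j ji; rewrite mxE (negPf ji) andbF scale0r.
exists (fun h => L << h >>); split=> [g h|c Lc|f fM].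
- have := LB << (g, h) >>; rewrite bar2E raddfD raddfB /= => /eqP.
  by rewrite addrAC subr_eq0 addrC => /eqP.
- have {}Lc x : L x *m c = 0.
    rewrite (freeg_sumZ x) linear_sum mulmx_suml big1 // => h _.
    by rewrite linearZ /= -scalemxAl Lc scaler0.
  by apply/row_matrixP=> i; rewrite row0 rowE -Lz Lc.
have [M Mh] : exists M : {linear {freeg H / F} -> F^o}, forall h, M << h >> = f h.
  pose f' : H -> F^o := f.
  pose M : {linear {freeg H / F} -> F^o} := HB.pack (fglift f')
    (GRing.isLinear.Build _ _ _ _ (fglift f') (fglift_is_linear f')).
  by exists M => h; rewrite /M /= liftU scale1r.
have MB b : M (bar2 b) = 0.
  rewrite (freeg_sumZ b) !linear_sum big1 // => -[g h] _.
  by rewrite !linearZ /= bar2E raddfD raddfB /= !Mh fM [f g + _]addrC opprD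
     addrA subrr sub0r addNr scaler0.
exists (\col_i M (z i)) => h; rewrite -Mh; have [b {1}->] := alP << h >>.
rewrite linearD MB addr0 linear_sum mxE; apply: eq_bigr => i _.
by rewrite linearZ /= mxE.
Qed.

(** * Cocycles and the Fox Jacobian *)

Lemma free_group_ind l (P : free_group l -> Prop) :
  P 1%g -> (forall u v, P u -> P v -> P (u * v)%g) ->
  (forall i, P (free_gen i)) -> (forall u, P u -> P u^-1%g) -> forall u, P u.
Proof.
move=> P1 PM Pg PV u; rewrite -(free_ofK u); elim: (word u) => [|[i b] w IH].
  by rewrite (_ : free_of [::] = 1%g).
rewrite -cat1s free_ofM; apply: PM => //; case: b; last exact: Pg.
rewrite (_ : free_of [:: (i, true)] = (free_gen i)^-1%g); first exact: PV.
exact: (free_of_linv (i, false)).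
Qed.

Section GroupRingMorph.
Variables (F : fieldType) (n : nat).

Lemma zlin_gr_map (V : zmodType) (A B : groupType) (f : A -> B) (mu : B -> V) u :
  zlin mu (gr_map f u) = zlin (fun x => mu (f x)) u.
Proof.
have h1 := @zlinB B V mu.
elim/gr_ind: u => [g|u v IHu IHv]; first by rewrite /gr_map !zlin1.
by rewrite /gr_map !raddfB /= -!/(gr_map f _) IHu IHv.
Qed.

Lemma zlin_mulmx (A : groupType) (mu : A -> 'M[F]_n) g u :
  {morph mu : x y / (x * y)%g >-> x *m y} ->
  zlin mu (gr g * u) = mu g *m zlin mu u.
Proof.
move=> muM; elim/gr_ind: u => [h|u v IHu IHv].
  by rewrite -grM !zlin1 muM.
by rewrite mulrBr !raddfB /= IHu IHv.
Qed.
End GroupRingMorph.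

(** The coefficient module is the space of F-valued functions on 'I_n, on
    which g acts by translation of the argument by act _ g. *)
Section PermutationCocycles.
Variables (F : fieldType) (G : groupType) (l m : nat).
Variables (r : 'I_m -> free_group l) (phi : UMagmaMorphism.type (free_group l) G).
Hypothesis hG : presentation r phi.
Variables (n : nat) (act : 'I_n -> G -> 'I_n).
Hypothesis act1 : forall y, act y 1%g = y.
Hypothesis actM : forall y g h, act y (g * h)%g = act (act y g) h.

Definition perm_action_mx (g : G) : 'M[F]_n := \matrix_(i, j) (act i g == j)%:R.

Lemma perm_action_mxM : {morph perm_action_mx : x y / (x * y)%g >-> x *m y}.
Proof.
move=> g h; apply/matrixP=> i j; rewrite !mxE (bigD1 (act i g)) //= big1 ?addr0.
  by rewrite !mxE eqxx mul1r actM.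
by move=> k ki; rewrite !mxE eq_sym (negPf ki) mul0r.
Qed.

Lemma mul_perm_action_mx_tr (x : 'rV[F]_n) g y :
  (x *m (perm_action_mx g)^T) 0 y = x 0 (act y g).
Proof.
rewrite mxE (bigD1 (act y g)) //= big1 ?addr0 => [|k ky]; last first.
  by rewrite !mxE eq_sym (negPf ky) mulr0.
by rewrite !mxE eqxx mulr1.
Qed.

Local Notation J := (specialize perm_action_mx (fox_jacobian r phi)).
Local Notation x_ j := (phi (free_gen j)).

(** A 1-cocycle with values in the functions on 'I_n, written as a function of
    two arguments. *)
Definition cocycle (s : 'I_n -> G -> F) :=
  forall y g h, s y (g * h)%g = s y g + s (act y g) h.

Definition cocycle_row (s : 'I_n -> G -> F) : 'rV[F]_(\sum_(j < l) n) :=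
  \mxrow_j \row_y s y (x_ j).

Lemma phi_inv u : phi u^-1%g = (phi u)^-1%g. Proof. exact: gmulfV. Qed.

Lemma cocycle1 s y : cocycle s -> s y 1%g = 0.
Proof.
by move=> cs; apply: (addrI (s y 1%g)); rewrite -{2}[y]act1 -cs mulg1 addr0.
Qed.

Lemma cocycleV s y g : cocycle s -> s y g^-1%g = - s (act y g^-1%g) g.
Proof.
by move=> cs; apply/eqP; rewrite -addr_eq0 -cs mulVg cocycle1.
Qed.

Lemma cocycle_eq0 s : cocycle s -> cocycle_row s = 0 -> forall y g, s y g = 0.
Proof.
move=> cs; rewrite /cocycle_row -mxrow0 => /eq_mxrowP E y g.
have [u <-] := hG.1 g.
elim/free_group_ind: u y => [|u v IHu IHv|i|u IH] y.
- by rewrite gmulf1 cocycle1.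
- by rewrite gmulfM cs IHu IHv addr0.
- by have /rowP/(_ y) := E i; rewrite !mxE.
by rewrite phi_inv cocycleV // IH oppr0.
Qed.

(** The derivation of the free group with values w on the generators. *)
Definition fox_cocycle (w : 'rV[F]_(\sum_(j < l) n)) (u : free_group l) :
    'rV[F]_n :=
  \sum_j submxrow w j *m
    (zlin (fun x => perm_action_mx (phi x)) (fox j (gr u)))^T.

Lemma fox_cocycleM w u v :
  fox_cocycle w (u * v)%g =
    fox_cocycle w u + fox_cocycle w v *m (perm_action_mx (phi u))^T.
Proof.
rewrite /fox_cocycle mulmx_suml -big_split; apply: eq_bigr => j _ /=.
rewrite grM foxM /augmentation zlin1 mulr1 raddfD /= zlin_mulmx.
  by rewrite raddfD /= mulmxDr trmx_mul mulmxA.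
by move=> g h; rewrite gmulfM perm_action_mxM.
Qed.

Lemma fox_cocycle_gen w i : fox_cocycle w (free_gen i) = submxrow w i.
Proof.
rewrite /fox_cocycle (bigD1 i) //= big1 ?addr0 => [|j ji]; last first.
  by rewrite fox_gen eq_sym (negPf ji) raddf0 trmx0 mulmx0.
rewrite fox_gen eqxx -(gr1 (free_group l)) zlin1 gmulf1.
rewrite (_ : perm_action_mx 1 = 1%:M) ?trmx1 ?mulmx1 //.
by apply/matrixP=> y z; rewrite !mxE act1.
Qed.

Lemma fox_jacobian_ker w :
  w *m J^T = 0 <-> forall i, fox_cocycle w (r i) = 0.
Proof.
rewrite /specialize tr_mxblock -[w in w *m _]submxrowK mul_mxrow_mxblock.
have E i : \sum_j submxrow w j *m (zlin perm_action_mx (fox_jacobian r phi i j))^T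
    = fox_cocycle w (r i).
  by apply: eq_bigr => j _; rewrite mxE zlin_gr_map.
split=> [w0 i|w0]; first by rewrite -E; move: w0; rewrite -mxrow0 => /eq_mxrowP.
by rewrite -[RHS]mxrow0; apply: eq_mxrow => i; rewrite E w0.
Qed.

Lemma fox_cocycleE s u y : cocycle s ->
  fox_cocycle (cocycle_row s) u 0 y = s y (phi u).
Proof.
move=> cs.
have fox0 : fox_cocycle (cocycle_row s) 1%g = 0.
  by rewrite /fox_cocycle big1 // => j _; rewrite gr1 fox1 raddf0 trmx0 mulmx0.
elim/free_group_ind: u y => [|u v IHu IHv|i|u IH] y.
- by rewrite fox0 mxE gmulf1 cocycle1.
- by rewrite fox_cocycleM mxE mul_perm_action_mx_tr IHu IHv gmulfM cs.
- by rewrite fox_cocycle_gen mxrowK mxE.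
have := congr1 (fun x : 'rV_n => x 0 y) fox0.
rewrite -(mulVg u) fox_cocycleM mxE mul_perm_action_mx_tr IH phi_inv [RHS]mxE.
move/eqP; rewrite addr_eq0 => /eqP->; apply/eqP; rewrite eq_sym -addr_eq0.
by rewrite -cs mulVg cocycle1.
Qed.

Lemma cocycle_row_ker s : cocycle s -> cocycle_row s *m J^T = 0.
Proof.
move=> cs; apply/fox_jacobian_ker => i; apply/rowP=> y.
rewrite fox_cocycleE // mxE (hG.2 _).2; last by apply: nc_gen; exists i.
exact: cocycle1.
Qed.

(** A derivation of the free group that vanishes on the relators vanishes on
    their normal closure, hence descends to G. *)
Lemma ker_cocycle_row w : w *m J^T = 0 ->
  exists2 s, cocycle s & w = cocycle_row s.
Proof.
move/fox_jacobian_ker=> w0; set D := fox_cocycle w.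
have D1 : D 1%g = 0.
  by rewrite /D /fox_cocycle big1 // => j _; rewrite gr1 fox1 raddf0 trmx0 mulmx0.
have Dy u v y : D (u * v)%g 0 y = D u 0 y + D v 0 (act y (phi u)).
  by rewrite [D (u * v)%g]fox_cocycleM mxE mul_perm_action_mx_tr.
have DV u y : D u^-1%g 0 y = - D u 0 (act y (phi u^-1%g)).
  by apply/eqP; rewrite -addr_eq0 -Dy mulVg D1 mxE.
have ker u : phi u = 1%g -> forall y, D u 0 y = 0.
  move/(hG.2 _).1; elim=> {u} [u [i ->] y|y|u v nu IHu _ IHv y|u nu IH y|u v nu IH y].
  - by rewrite [D _]w0 mxE.
  - by rewrite D1 mxE.
  - by rewrite Dy IHu IHv addr0.
  - by rewrite DV IH oppr0.
  rewrite conjgE Dy DV Dy IH add0r phi_inv ((hG.2 _).2 nu) act1.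
  by rewrite addNr.
have well u v : phi u = phi v -> D u = D v.
  move=> E; apply/rowP=> y; rewrite -[u](mulgKV v) Dy.
  have uv : phi (u * v^-1)%g = 1%g by rewrite gmulfM phi_inv E mulgV.
  by rewrite ker // add0r uv act1.
have lift g : exists u, phi u == g by have [u <-] := hG.1 g; exists u.
pose s y g := D (xchoose (lift g)) 0 y.
have sE y u : s y (phi u) = D u 0 y.
  by rewrite /s (well _ u) //; apply/eqP; exact: (xchooseP (lift _)).
exists s => [y g h|].
  have [u <-] := hG.1 g; have [v <-] := hG.1 h.
  by rewrite -gmulfM !sE Dy.
rewrite -[LHS]submxrowK; apply: eq_mxrow => j; apply/rowP=> y.
by rewrite [RHS]mxE sE /D fox_cocycle_gen.
Qed.
End PermutationCocycles.

(** * Shapiro's lemma for a transitive action *)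

(** The group H is the stabilizer of the point i0, embedded by iota. *)
Section TransitiveAction.
Variables (F : fieldType) (G : groupType) (l m : nat).
Variables (r : 'I_m -> free_group l) (phi : UMagmaMorphism.type (free_group l) G).
Hypothesis hG : presentation r phi.
Variables (n : nat) (act : 'I_n -> G -> 'I_n).
Hypothesis act1 : forall y, act y 1%g = y.
Hypothesis actM : forall y g h, act y (g * h)%g = act (act y g) h.
Variable i0 : 'I_n.
Hypothesis act_trans : forall y, exists g, act i0 g = y.
Variables (H : groupType) (iota : H -> G).
Hypothesis iotaM : {morph iota : x y / (x * y)%g}.
Hypothesis iota_inj : injective iota.
Hypothesis iota_stab : forall g, act i0 g = i0 <-> exists h, iota h = g.

Local Notation C1 := {freeg H / F}.
Local Notation x_ j := (phi (free_gen j)).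
Local Notation J := (specialize (perm_action_mx F act) (fox_jacobian r phi)).

Let iota1 : iota 1%g = 1%g.
Proof. by apply: (mulgI (iota 1%g)); rewrite -iotaM !mulg1. Qed.

Let transE y : exists g, act i0 g == y.
Proof. by have [g <-] := act_trans y; exists g. Qed.
Let t y : G := xchoose (transE y).
Let act_t y : act i0 (t y) = y. Proof. exact/eqP/(xchooseP (transE y)). Qed.

Let schreierP y g : exists h, iota h == (t y * g * (t (act y g))^-1)%g.
Proof.
have [h <-] : exists h, iota h = (t y * g * (t (act y g))^-1)%g.
  apply/iota_stab; rewrite !actM act_t -{1}(act_t (act y g)) -actM mulgV.
  exact: act1.
by exists h.
Qed.

Definition schreier y g : H := xchoose (schreierP y g).

Lemma schreierE y g : iota (schreier y g) = (t y * g * (t (act y g))^-1)%g.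
Proof. exact/eqP/(xchooseP (schreierP y g)). Qed.

Lemma schreierM y g h :
  schreier y (g * h)%g = (schreier y g * schreier (act y g) h)%g.
Proof.
by apply: iota_inj; rewrite iotaM !schreierE actM !mulgA mulgKV.
Qed.

Lemma schreier1 y : schreier y 1%g = 1%g.
Proof. by apply: iota_inj; rewrite schreierE act1 mulg1 mulgV iota1. Qed.

(** The element chosen for i0 is in H but need not be 1. *)
Lemma schreier_base :
  exists k, forall h, schreier i0 (iota h) = (k * h * k^-1)%g.
Proof.
have [k kE] : exists k, iota k = t i0 by apply/iota_stab.
exists k => h; apply: iota_inj; rewrite schreierE.
have -> : act i0 (iota h) = i0 by apply/iota_stab; exists h.
have -> : iota (k * h * k^-1)%g = (iota k * iota h * (iota k)^-1)%g.
  by apply: (mulIg (iota k)); rewrite -iotaM !mulgKV iotaM.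
by rewrite kE.
Qed.

Lemma boundaryM g h : boundary (<< g >> + << h >> - << (g * h)%g >> : C1).
Proof. by exists << (g, h) >>; rewrite bar2E [RHS]addrC addrA. Qed.

Let S (a : 'I_n * 'I_l -> F) : C1 := \sum_p a p *: << schreier p.1 (x_ p.2) >>.

Let SD a b : S (fun p => a p + b p) = S a + S b.
Proof. by rewrite /S -big_split; apply: eq_bigr => p _; rewrite scalerDl. Qed.

Let SN a : S (fun p => - a p) = - S a.
Proof. by rewrite /S -sumrN; apply: eq_bigr => p _; rewrite scaleNr. Qed.

Definition schreier_spanned (h : H) := exists a, boundary (<< h >> - S a).

Lemma boundary1 : boundary (<< 1%g >> : C1).
Proof. by have := boundaryM 1%g 1%g; rewrite mulg1 addrK. Qed.

Lemma schreier_spannedM g h :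
  schreier_spanned g -> schreier_spanned h -> schreier_spanned (g * h)%g.
Proof.
case=> a ba [b bb]; exists (fun p => a p + b p); rewrite SD.
have := boundaryB (boundaryD ba bb) (boundaryM g h); congr boundary.
set x := << g >>; set y := << h >>; set z := << _ >>.
have -> : x - S a + (y - S b) = (x + y) - (S a + S b) by rewrite addrACA -opprD.
by set w := x + y; set v := _ + S b; rewrite opprB addrCA (addrAC w) subrr add0r.
Qed.

Lemma schreier_spanned1 : schreier_spanned 1%g.
Proof.
exists (fun=> 0); rewrite /S big1 ?subr0 => [|p _]; last by rewrite scale0r.
exact: boundary1.
Qed.

Lemma schreier_spannedV g : schreier_spanned g -> schreier_spanned g^-1%g.
Proof.
case=> a ba; exists (fun p => - a p); rewrite SN opprK.
have := boundaryB (boundaryD (boundaryM g g^-1%g) boundary1) ba.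
rewrite mulgV subrK; congr boundary; set x := << g >>; set y := << _ >>.
by rewrite opprB (addrC (x + y)) addrA (subrK x) (addrC y).
Qed.

Lemma schreier_spannedE u y : schreier_spanned (schreier y (phi u)).
Proof.
elim/free_group_ind: u y => [|u v IHu IHv|j|u IH] y.
- by rewrite gmulf1 schreier1; apply: schreier_spanned1.
- by rewrite gmulfM schreierM; apply: schreier_spannedM.
- exists (fun p => (p == (y, j))%:R); rewrite /S (bigD1 (y, j)) //= eqxx scale1r.
  rewrite big1 ?addr0 ?subrr => [|p /negPf->]; last by rewrite scale0r.
  by exists 0; rewrite raddf0.
have -> : schreier y (phi u^-1%g) = (schreier (act y (phi u)^-1%g) (phi u))^-1%g.
  apply: (mulIg (schreier (act y (phi u)^-1%g) (phi u))).
  by rewrite mulVg gmulfV -schreierM mulVg schreier1.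
exact: schreier_spannedV.
Qed.

(** Schreier's generation argument: t_y g (t_(yg))^-1 is multiplicative along
    a word, so the Schreier elements of the generators span the homology of
    H. *)
Lemma stab_H1_dim_exists : exists b, H1_dim F H b.
Proof.
apply: (@H1_dim_exists _ _ _ (fun p : 'I_n * 'I_l => schreier p.1 (x_ p.2))) => h.
have [k kE] := schreier_base; have [u uE] := hG.1 (iota h).
have [a ba] := schreier_spannedE u i0; exists a; rewrite uE kE in ba.
have := boundaryB ba (boundaryB (boundaryM (k * h * k^-1)%g k) (boundaryM k h)).
rewrite mulgKV; congr (boundary _).
set x := << (_ * k^-1)%g >>; set y := << k >>; set z := << (k * h)%g >>.
set w := << h >>; rewrite -/(S a).
have -> : x + y - z - (y + w - z) = x - w.
  by rewrite opprB addrA subrK opprD addrA addrK.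
by rewrite opprB addrCA (addrAC x) subrr add0r.
Qed.

Let coh (f : H -> F) y g := f (schreier y g).
Let cob (u : 'I_n -> F) y g := u y - u (act y g).

Lemma hom_cocycle f : (forall g h, f (g * h)%g = f g + f h) -> cocycle act (coh f).
Proof. by move=> fM y g h; rewrite /coh schreierM fM. Qed.

Lemma coboundary_cocycle u : cocycle act (cob u).
Proof. by move=> y g h; rewrite /cob actM addrA subrK. Qed.

Lemma cocycleD s s' : cocycle act s -> cocycle act s' ->
  cocycle act (fun y g => s y g + s' y g : F).
Proof. by move=> cs cs' y g h; rewrite cs cs' addrACA. Qed.

Lemma hom_schreier f h : (forall g h, f (g * h)%g = f g + f h :> F) ->
  coh f i0 (iota h) = f h.
Proof.
move=> fM; rewrite /coh; have [k ->] := schreier_base.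
have f1 : f 1%g = 0 by apply: (addrI (f 1%g)); rewrite -fM mulg1 addr0.
have fV : f k^-1%g = - f k by apply/eqP; rewrite -addr_eq0 -fM mulVg f1.
by rewrite !fM fV addrAC subrr add0r.
Qed.

(** The homomorphism attached to s is its restriction to H at i0, and the
    coboundary corrects for the choice of the elements t y. *)
Lemma cocycle_decomp s : cocycle act s ->
  exists (f : H -> F) (u : 'I_n -> F),
    (forall g h : H, f (g * h)%g = f g + f h) /\
    (forall y g, s y g = coh f y g + cob u y g).
Proof.
move=> cs.
exists (fun h => s i0 (iota h)), (fun y => - s i0 (t y)); split=> [g h|y g].
  by rewrite iotaM cs; have -> : act i0 (iota g) = i0 by apply/iota_stab; exists g.
rewrite /coh /cob schreierE !cs actM act_t opprK.
have -> : s (act y g) (t (act y g))^-1%g = - s i0 (t (act y g)).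
  apply/eqP; rewrite -addr_eq0 addrC -{2}(act_t (act y g)) -cs mulgV.
  by rewrite (cocycle1 act1).
by rewrite addrCA subrK addrA addNr add0r.
Qed.

(** The rows of A1 a are the cocycles coinduced from the homomorphisms given by
    the coordinates of a, those of A2 the coboundaries of indicator functions. *)
Let A1 b (a : H -> 'rV[F]_b) : 'M[F]_(b, \sum_(j < l) n) :=
  \mxrow_j \matrix_(k, y) a (schreier y (x_ j)) 0 k.
Let A2 : 'M[F]_(n, \sum_(j < l) n) :=
  \mxrow_j \matrix_(k, y) ((k == y)%:R - (k == act y (x_ j))%:R).

Let mulA1 b (a : H -> 'rV[F]_b) (c : 'rV_b) :
  c *m A1 a = cocycle_row phi (coh (fun h => (a h *m c^T) 0 0)).
Proof.
rewrite /A1 mul_mxrow; apply: eq_mxrow => j; apply/rowP=> y; rewrite /coh !mxE.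
by apply: eq_bigr => k _; rewrite !mxE mulrC.
Qed.

Let mulA2 (c : 'rV_n) : c *m A2 = cocycle_row phi (cob (c 0)).
Proof.
rewrite /A2 mul_mxrow; apply: eq_mxrow => j; apply/rowP=> y; rewrite !mxE.
have sum1 z : \sum_k c 0 k * (k == z)%:R = c 0 z.
  rewrite (bigD1 z) //= eqxx mulr1 big1 ?addr0 // => k /negPf->.
  by rewrite mulr0.
rewrite /cob -!sum1 -sumrB; apply: eq_bigr => k _.
by rewrite mxE mulrBr.
Qed.

Let cocycle_rowD (s s' : 'I_n -> G -> F) :
  cocycle_row phi (fun y g => s y g + s' y g) = cocycle_row phi s + cocycle_row phi s'.
Proof.
by rewrite -mxrowD; apply: eq_mxrow => j; apply/rowP=> y; rewrite !mxE.
Qed.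

(** A function with zero coboundary is constant, by transitivity. *)
Let rank_A2 : (\rank A2 + 1)%N = n.
Proof.
have kerE : (kermx A2 :=: (const_mx 1 : 'rV[F]_n))%MS.
  apply/eqmxP/rV_eqP => u; apply/sub_kermxP/sub_rVP.
    rewrite mulA2 => u0; exists (u 0 i0); apply/rowP=> y; rewrite !mxE mulr1.
    have E := cocycle_eq0 hG act1 (coboundary_cocycle (u 0)) u0.
    by have [g <-] := act_trans y; have /eqP := E i0 g; rewrite subr_eq0 => /eqP.
  case=> c ->; rewrite mulA2 -mxrow0; apply: eq_mxrow => j; apply/rowP=> z.
  by rewrite !mxE /cob !mxE subrr.
have nz : (const_mx 1 : 'rV[F]_n) != 0.
  by apply/eqP=> /rowP/(_ i0)/eqP; rewrite !mxE oner_eq0.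
have := mxrank_ker A2; rewrite kerE rank_rV nz => E.
by rewrite -[1%N]/(nat_of_bool true) E subnKC // rank_leq_row.
Qed.

(** The cocycles are the direct sum of the homomorphisms from H to F and of
    the coboundaries. *)
Theorem stab_H1_dim :
  exists b, H1_dim F H b /\
    (b + n)%N = (corank (perm_action_mx F act) (fox_jacobian r phi) + 1)%N.
Proof.
have [b Hb] := stab_H1_dim_exists; exists b; split=> //.
have [a [aM a_free a_full]] := H1_dim_dual Hb.
have homa (c : 'rV_b) g h :
    (a (g * h)%g *m c^T) 0 0 = (a g *m c^T) 0 0 + (a h *m c^T) 0 0.
  by rewrite aM mulmxDl mxE.
have indep (c : 'rV_b) (u : 'rV_n) : c *m A1 a + u *m A2 = 0 -> c = 0.
  rewrite mulA1 mulA2 -cocycle_rowD => v0.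
  have E := cocycle_eq0 hG act1 (cocycleD (hom_cocycle (homa c))
    (coboundary_cocycle (u 0))) v0.
  apply: trmx_inj; rewrite trmx0; apply: a_free => h.
  apply/rowP=> k; rewrite [RHS]mxE !ord1 -(hom_schreier h (homa c)).
  have := E i0 (iota h); rewrite /cob.
  have -> : act i0 (iota h) = i0 by apply/iota_stab; exists h.
  by rewrite subrr addr0.
have free1 : row_free (A1 a).
  rewrite -kermx_eq0; apply/rowV0P => c /sub_kermxP c0.
  by apply: (indep c 0); rewrite c0 mul0mx addr0.
have cap0 : (A1 a :&: A2 = 0)%MS.
  apply/eqP/rowV0P => v; rewrite sub_capmx => /andP[/submxP[c ->] /submxP[u E]].
  by rewrite (indep c (- u)) ?mul0mx // E mulNmx subrr.
have kerE : (kermx J^T :=: A1 a + A2)%MS.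
  apply/eqmxP/rV_eqP => w; apply/sub_kermxP/sub_addsmxP.
    case/(ker_cocycle_row hG act1 actM) => s cs ->.
    have [f [u [fM sE]]] := cocycle_decomp cs; have [c fE] := a_full f fM.
    exists (c^T, \row_y u y); rewrite mulA1 mulA2 -cocycle_rowD; apply: eq_mxrow => j.
    apply/rowP=> y; rewrite !mxE sE /coh /cob fE trmxK !mxE.
    by [].
  case=> [[c u] /= ->]; rewrite mulA1 mulA2 -cocycle_rowD; apply: cocycle_row_ker => //.
  exact: cocycleD (hom_cocycle (homa c)) (coboundary_cocycle _).
have := mxrank_ker J^T; rewrite kerE mxrank_disjoint_sum // mxrank_tr.
rewrite (eqP free1) => E; rewrite /corank.
have <- : (\sum_(j < l) n)%N = (l * n)%N by rewrite sum_nat_const card_ord.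
rewrite -E.
by rewrite -addnA rank_A2.
Qed.
End TransitiveAction.

(** * Additivity of the rank of a specialized Jacobian *)

Section BlockDiag.
Variable K : fieldType.

Definition blockdiag k a b (P : 'M[K]_(a, b)) :
    'M_(\sum_(i < k) a, \sum_(j < k) b) :=
  \mxblock_(i < k, j < k) ((i == j)%:R *: P).

Lemma mul_blockdiag_mxblock k p a b c (P : 'M[K]_(a, b))
    (X : 'I_k -> 'I_p -> 'M[K]_(b, c)) :
  blockdiag k P *m (\mxblock_(i < k, j < p) X i j) =
    \mxblock_(i < k, j < p) (P *m X i j).
Proof.
rewrite mul_mxblock; apply: eq_mxblock => i j; rewrite (bigD1 i) //= big1 ?addr0.
  by rewrite eqxx scale1r.
by move=> k' ne; rewrite eq_sym (negPf ne) scale0r mul0mx.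
Qed.

Lemma mul_mxblock_blockdiag k p a b c (P : 'M[K]_(b, c))
    (X : 'I_p -> 'I_k -> 'M[K]_(a, b)) :
  (\mxblock_(i < p, j < k) X i j) *m blockdiag k P =
    \mxblock_(i < p, j < k) (X i j *m P).
Proof.
rewrite mul_mxblock; apply: eq_mxblock => i j; rewrite (bigD1 j) //= big1 ?addr0.
  by rewrite eqxx scale1r.
by move=> k' ne; rewrite (negPf ne) scale0r mulmx0.
Qed.

Lemma blockdiagM k a b c (P : 'M[K]_(a, b)) (Q : 'M[K]_(b, c)) :
  blockdiag k (P *m Q) = blockdiag k P *m blockdiag k Q.
Proof.
by rewrite mul_blockdiag_mxblock; apply: eq_mxblock => i j; rewrite scalemxAr.
Qed.

Lemma blockdiag1 k a : blockdiag k (1%:M : 'M[K]_a) = 1%:M.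
Proof.
have E : \mxblock_(i < k, j < k) submxblock (1%:M : 'M[K]_(\sum_(i < k) a)) i j = 1%:M.
  exact: submxblockK.
rewrite -[LHS]mulmx1 -E mul_blockdiag_mxblock.
by apply: eq_mxblock => i j; rewrite mul1mx.
Qed.

Lemma blockdiag_sum k a b (I : finType) (P : I -> 'M[K]_(a, b)) :
  blockdiag k (\sum_i P i) = \sum_i blockdiag k (P i).
Proof. by rewrite -mxblock_sum; apply: eq_mxblock => i j; rewrite scaler_sumr. Qed.

Lemma blockdiag_free k a b (P : 'M[K]_(a, b)) :
  row_free P -> row_free (blockdiag k P).
Proof.
case/row_freeP=> Q PQ; apply/row_freeP; exists (blockdiag k Q).
by rewrite -blockdiagM PQ blockdiag1.
Qed.

Lemma blockdiag_full k a b (P : 'M[K]_(a, b)) :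
  row_full P -> row_full (blockdiag k P).
Proof.
case/row_fullP=> Q QP; apply/row_fullP; exists (blockdiag k Q).
by rewrite -blockdiagM QP blockdiag1.
Qed.

Lemma rank_blockdiag k a b (P : 'M[K]_(a, b)) :
  \rank (blockdiag k P) = (k * \rank P)%N.
Proof.
rewrite -{1}(mulmx_base P) blockdiagM mxrankMfree ?blockdiag_free ?row_base_free //.
have /eqP-> : row_full (blockdiag k (col_base P)).
  by rewrite blockdiag_full ?col_base_full.
by rewrite sum_nat_const card_ord.
Qed.

Lemma blockdiagS k a a' b (P : 'M[K]_(a, b)) (Q : 'M[K]_(a', b)) :
  (P <= Q)%MS -> (blockdiag k P <= blockdiag k Q)%MS.
Proof. by case/submxP=> D ->; rewrite blockdiagM submxMl. Qed.

Lemma blockdiag_sums k b (I : finType) (U : I -> 'M[K]_b) :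
  (blockdiag k (\sum_i U i)%MS :=: \sum_i blockdiag k (U i))%MS.
Proof.
apply/eqmxP/andP; split; last first.
  by apply/sumsmx_subP=> i _; rewrite blockdiagS // (sumsmx_sup i).
have /sub_sumsmxP[D ->] : (\sum_i U i <= \sum_i U i)%MS by [].
rewrite blockdiag_sum; apply: summx_sub_sums => i _.
by rewrite blockdiagM submxMl.
Qed.

Lemma blockdiag_direct k b (I : finType) (U : I -> 'M[K]_b) :
  mxdirect (\sum_i U i) -> mxdirect (\sum_i blockdiag k (U i)).
Proof.
move=> dxU; apply/mxdirectP => /=.
rewrite -(blockdiag_sums k U) rank_blockdiag (mxdirectP dxU) /= big_distrr /=.
by apply: eq_bigr => i _; rewrite rank_blockdiag.
Qed.
End BlockDiag.

Section JacobianRank.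
Variables (K : fieldType) (G : groupType) (n m l : nat) (mu : G -> 'M[K]_n).
Variable J : 'M[group_ring_of G]_(m, l).

(** The rank of the Jacobian specialized at the submodule P.  Working inside one
    representation avoids a change of basis when P is decomposed. *)
Definition sub_rank k (P : 'M[K]_(k, n)) :=
  \rank (blockdiag m P *m specialize mu J).

Lemma sub_rankS k k' (P : 'M[K]_(k, n)) (Q : 'M[K]_(k', n)) :
  (P <= Q)%MS ->
  (blockdiag m P *m specialize mu J <= blockdiag m Q *m specialize mu J)%MS.
Proof. by move=> sPQ; apply/submxMr/blockdiagS. Qed.

Lemma eq_sub_rank k k' (P : 'M[K]_(k, n)) (Q : 'M[K]_(k', n)) :
  (P :=: Q)%MS -> sub_rank P = sub_rank Q.
Proof.
by move=> PQ; apply/eqP; rewrite eqn_leq !mxrankS ?sub_rankS ?PQ.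
Qed.

Lemma sub_rank1 : sub_rank 1%:M = \rank (specialize mu J).
Proof. by rewrite /sub_rank blockdiag1 mul1mx. Qed.

Lemma zlin_intertwine a (nu : G -> 'M[K]_a) (P : 'M[K]_(a, n)) u :
  (forall g, nu g *m P = P *m mu g) -> zlin nu u *m P = P *m zlin mu u.
Proof.
move=> E; elim/gr_ind: u => [g|u v IHu IHv]; first by rewrite !zlin1 E.
by rewrite !raddfB /= mulmxBl IHu IHv.
Qed.

Lemma sub_rank_intertwine a (nu : G -> 'M[K]_a) (P : 'M[K]_(a, n)) :
  row_free P -> (forall g, nu g *m P = P *m mu g) ->
  sub_rank P = \rank (specialize nu J).
Proof.
move=> freeP E; rewrite -(mxrankMfree _ (blockdiag_free l freeP)).
rewrite /sub_rank mul_blockdiag_mxblock mul_mxblock_blockdiag; congr (\rank _).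
by apply: eq_mxblock => i j; rewrite (zlin_intertwine _ E).
Qed.

Lemma zlin_stable k (P : 'M[K]_(k, n)) u :
  (forall g, P *m mu g <= P)%MS -> (P *m zlin mu u <= P)%MS.
Proof.
move=> stP; elim/gr_ind: u => [g|u v IHu IHv]; first by rewrite zlin1.
by rewrite raddfB /= mulmxBr addmx_sub // eqmx_opp.
Qed.

Lemma sub_rank_stable k (P : 'M[K]_(k, n)) : (forall g, P *m mu g <= P)%MS ->
  (blockdiag m P *m specialize mu J <= blockdiag l P)%MS.
Proof.
move=> stP; rewrite mul_blockdiag_mxblock.
pose X i j := P *m zlin mu (J i j) *m pinvmx P.
rewrite (_ : \mxblock_(i, j) _ = (\mxblock_(i < m, j < l) X i j) *m blockdiag l P).
  exact: submxMl.
rewrite mul_mxblock_blockdiag; apply: eq_mxblock => i j.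
by rewrite /X mulmxKpV // zlin_stable.
Qed.

(** The image of a submodule stays in the corresponding submodule of the
    target, so the images of the summands are independent. *)
Lemma sub_rank_sum (I : finType) (U : I -> 'M[K]_n) :
  (forall i g, U i *m mu g <= U i)%MS -> mxdirect (\sum_i U i) ->
  sub_rank (\sum_i U i)%MS = (\sum_i sub_rank (U i))%N.
Proof.
move=> stU dxU; rewrite /sub_rank.
rewrite (eqmxMr _ (blockdiag_sums m U)) sumsmxMr_gen.
have dx : mxdirect (\sum_i <<blockdiag m (U i) *m specialize mu J>>%MS).
  apply/mxdirect_sumsP=> i _; apply/eqP; rewrite -submx0.
  have sub j : (<<blockdiag m (U j) *m specialize mu J>> <= blockdiag l (U j))%MS.
    by rewrite genmxE sub_rank_stable.
  have subs : (\sum_(j | j != i) <<blockdiag m (U j) *m specialize mu J>> <=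
      \sum_(j | j != i) blockdiag l (U j))%MS.
    by apply/sumsmx_subP=> j ji; rewrite (sumsmx_sup j).
  have := capmxS (sub i) subs.
  by rewrite (mxdirect_sumsP (blockdiag_direct l dxU) i isT).
by rewrite (mxdirectP dx) /=; apply: eq_bigr => i _; rewrite genmxE.
Qed.

(** Isomorphic submodules have equal rank. *)
Lemma sub_rank_hom k (P : 'M[K]_(k, n)) (f : 'M[K]_n) :
  f \in unitmx -> (forall g, P *m f *m mu g = P *m mu g *m f) ->
  sub_rank (P *m f) = sub_rank P.
Proof.
move=> uf E; have ff : row_free (blockdiag l f) by rewrite blockdiag_free ?row_free_unit.
rewrite /sub_rank -[RHS](mxrankMfree _ ff) !mul_blockdiag_mxblock mul_mxblock_blockdiag.
congr (\rank _); apply: eq_mxblock => i j.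
elim/gr_ind: (J i j) => [g|u v IHu IHv]; first by rewrite zlin1.
by rewrite raddfB /= !mulmxBr IHu IHv mulmxBl.
Qed.
End JacobianRank.

(** * The regular representation and the Betti numbers *)

Section Regular.
Variables (K : fieldType) (gT : finGroupType).
Local Notation GG := [set: gT]%G.
Variable sG : irrType K GG.
Hypotheses (K'G : pgroup [pchar K]^' GG) (splitG : group_splitting_field K GG).
Variables (X : groupType) (lam : X -> gT).
Variables (m l : nat) (J : 'M[group_ring_of X]_(m, l)).

Local Notation irr_corank i := (corank (fun x => irr_repr i (lam x)) J).

(** Over a splitting field the component of an irreducible representation is
    the sum of as many copies of it as its degree. *)
Lemma sub_rank_socle (i : sG) :
  sub_rank (fun x => regular_mx K GG (lam x)) J i =
    (irr_degree i * \rank (specialize (fun x => irr_repr i (lam x)) J))%N.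
Proof.
set mu := fun x => regular_mx K GG (lam x).
have [I [U [isoU defU dxU cardI]]] := socle_decomposition i.
have stU a x : (U a *m mu x <= U a)%MS.
  have modU := mx_iso_module (isoU a) (socle_module i).
  by apply: (mxmoduleP modU); rewrite inE.
rewrite -(eq_sub_rank mu J defU) sub_rank_sum //.
transitivity (#|I| * \rank (specialize (fun x => irr_repr i (lam x)) J))%N.
  2: by congr (_ * _)%N; rewrite cardI irr_mx_mult_pchar.
rewrite -sum_nat_const; apply: eq_bigr => a _.
have [f uf homf Uf] := isoU a; rewrite -(eq_sub_rank mu J Uf).
rewrite sub_rank_hom //; last first.
  by move=> x; have := hom_mxP homf (lam x); rewrite inE => /(_ isT).
rewrite -(eq_sub_rank mu J (eq_row_base _)).
apply: sub_rank_intertwine; first exact: row_base_free.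
move=> x; rewrite -[irr_repr i (lam x)]mul1mx.
have := val_submodJ (socle_module i) (1%:M : 'M_(\rank (socle_base i))) (in_setT (lam x)).
by rewrite /val_submod /= !mul1mx.
Qed.

Lemma corank_regular :
  corank (fun x => regular_mx K GG (lam x)) J =
    (\sum_(i : sG) irr_degree i * irr_corank i)%N.
Proof.
set mu := fun x => regular_mx K GG (lam x).
have rk : \rank (specialize mu J) =
    (\sum_(i : sG) irr_degree i * \rank (specialize (fun x => irr_repr i (lam x)) J))%N.
  rewrite -sub_rank1 -(irr_mx_sum_pchar sG K'G).
  rewrite sub_rank_sum; first by apply: eq_bigr => i _; apply: sub_rank_socle.
    move=> i x; apply: (mxmoduleP (component_mx_module _ (socle_base i))).
    by rewrite inE.
  exact: Socle_direct.
have rle (i : sG) :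
    (\rank (specialize (fun x => irr_repr i (lam x)) J) <= l * irr_degree i)%N.
  by apply: leq_trans (rank_leq_col _) _; rewrite sum_nat_const card_ord.
rewrite /corank rk; apply/eqP; rewrite -(eqn_add2r (\sum_(i : sG)
  irr_degree i * \rank (specialize (fun x => irr_repr i (lam x)) J))).
rewrite subnK; last first.
  rewrite -rk; apply: leq_trans (rank_leq_col _) _.
  by rewrite sum_nat_const card_ord.
rewrite -big_split /=; apply/eqP.
transitivity (l * \sum_(i : sG) irr_degree i ^ 2)%N.
  by congr (_ * _)%N; rewrite sum_irr_degree_pchar.
rewrite big_distrr /=; apply: eq_bigr => i _.
by rewrite -mulnDr subnK // mulnCA expnS expn1 mulnA.
Qed.
End Regular.

Lemma eq_corank (G : groupType) (K : fieldType) n m l (mu nu : G -> 'M[K]_n)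
    (J : 'M[group_ring_of G]_(m, l)) : mu =1 nu -> corank mu J = corank nu J.
Proof. by move=> /funext->. Qed.

Lemma map_zlin (G : groupType) (F K : fieldType) (f : {rmorphism F -> K}) n
    (mu : G -> 'M[F]_n) u :
  map_mx f (zlin mu u) = zlin (fun x => map_mx f (mu x)) u.
Proof.
elim/gr_ind: u => [g|u v IHu IHv]; first by rewrite !zlin1.
by rewrite raddfB map_mxB IHu IHv raddfB.
Qed.

Lemma map_corank (G : groupType) (F K : fieldType) (f : {rmorphism F -> K})
    n m l (mu : G -> 'M[F]_n) (J : 'M[group_ring_of G]_(m, l)) :
  corank (fun x => map_mx f (mu x)) J = corank mu J.
Proof.
rewrite /corank -(mxrank_map f (specialize mu J)); congr (_ - \rank _)%N.
by apply/matrixP=> i j; rewrite !mxE -map_zlin !mxE.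
Qed.

Lemma rat_rmorphism (K : fieldType) : [pchar K] =i pred0 ->
  inhabited {rmorphism rat -> K}.
Proof.
move=> K0; have nz (n : int) : n != 0 -> n%:~R != 0 :> K.
  case: n => n; rewrite ?NegzE ?mulrNz ?oppr_eq0 -?pmulrn ((pcharf0P K).1 K0) //.
pose f (x : rat) : K := (numq x)%:~R / (denq x)%:~R.
have fE (a b : int) : b != 0 -> f (a%:Q / b%:Q) = a%:~R / b%:~R.
  move=> nzb; rewrite /f; set x := a%:Q / b%:Q.
  have nzd : denq x != 0 := denq_neq0 x.
  apply/eqP; rewrite eqr_div ?nz // -!intrM; apply/eqP; congr _%:~R.
  apply: (@intr_inj rat); rewrite !intrM.
  apply/eqP; rewrite -eqr_div ?intr_eq0 // divq_num_den.
  by [].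
have fB : zmod_morphism f.
  move=> x y; rewrite -{1}[x]divq_num_den -{1}[y]divq_num_den.
  have nzx := denq_neq0 x; have nzy := denq_neq0 y.
  rewrite -mulNr addf_div ?intr_eq0 // -mulrNz -!intrM -intrD fE ?mulf_neq0 //.
  rewrite /f -mulNr addf_div ?nz // -mulrNz -!intrM -intrD.
  by [].
have fM : monoid_morphism f.
  split; first by rewrite /f divr1.
  move=> x y; rewrite -{1}[x]divq_num_den -{1}[y]divq_num_den mulf_div.
  by rewrite -!intrM fE ?mulf_neq0 ?denq_neq0 // !intrM -mulf_div.
split; exact: (HB.pack f (GRing.isZmodMorphism.Build _ _ f fB)
                         (GRing.isMonoidMorphism.Build _ _ f fM)).
Qed.

Lemma prime_field_rmorphism (K : fieldType) q : has_char K q ->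
  inhabited {rmorphism prime_field q -> K}.
Proof.
case: q => [|q] /= hq; first exact: rat_rmorphism.
split.
exact: (in_alg (pPrimeCharType hq) : {rmorphism 'F_q.+1 -> pPrimeCharType hq}).
Qed.

Lemma map_perm_action_mx (F K : fieldType) (f : {rmorphism F -> K})
    (G : groupType) n (act : 'I_n -> G -> 'I_n) g :
  map_mx f (perm_action_mx F act g) = perm_action_mx K act g.
Proof. by apply/matrixP=> i j; rewrite !mxE rmorph_nat. Qed.

Lemma corank_trivial (K : fieldType) (G : groupType) n m l (mu : G -> 'M[K]_n)
    (J : 'M[group_ring_of G]_(m, l)) :
  n = 1%N -> (forall x, mu x = 1%:M) ->
  corank mu J = corank (perm_action_mx K (fun (i : 'I_1) (_ : G) => i)) J.
Proof.
move=> n1; case: _ / (esym n1) mu => mu mu1; apply: eq_corank => x.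
by rewrite mu1; apply/matrixP=> i j; rewrite !mxE.
Qed.

Section Kernel.
Variables (G : groupType) (gT : finGroupType) (lambda : UMagmaMorphism.type G gT).
Local Notation GG := [set: gT]%G.

Definition regular_act (i : 'I_#|GG|) (g : G) : 'I_#|GG| :=
  gring_index GG (enum_val i * lambda g)%g.

Lemma regular_act1 i : regular_act i 1%g = i.
Proof. by rewrite /regular_act gmulf1 mulg1 gring_valK. Qed.

Lemma regular_actM i g h :
  regular_act i (g * h)%g = regular_act (regular_act i g) h.
Proof. by rewrite /regular_act gmulfM mulgA gring_indexK ?inE. Qed.

Lemma perm_action_mx_regular (K : fieldType) :
  perm_action_mx K regular_act =1 (fun x => regular_mx K GG (lambda x)).
Proof. by move=> x; apply/matrixP=> i j; rewrite !mxE eq_sym. Qed.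

End Kernel.

Theorem theorem4p6 (G : groupType) (l m : nat) (r : 'I_m -> free_group l)
  (phi : UMagmaMorphism.type (free_group l) G)
  (hG : presentation r phi)
  (gT : finGroupType) (lambda : UMagmaMorphism.type G gT)
  (lambda_surj : forall y : gT, exists x : G, lambda x = y)
  (K : fieldType) (hK : sufficiently_large K gT)
  (q : nat) (hq : has_char K q)
  (irrK : irrType K [set: gT]) :
  exists bK bG : nat,
    [/\ betti1 q (kernel lambda) bK, betti1 q G bG &
        bK%:Z = bG%:Z +
          \sum_(i : irrK | i != [1 irrK]%irr)
             (irr_degree i)%:Z *
             ((corank (fun x : G => irr_repr i (lambda x))
                      (fox_jacobian r phi))%:Z - (irr_degree i)%:Z)].
Proof.
pose GG := [set: gT]%G; set J := fox_jacobian r phi.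
have K'G : pgroup [pchar K]^' GG.
  apply/pgroupP=> p p_pr pG; rewrite inE /=; apply/negP=> chp.
  have hp : has_char K p by case: p p_pr chp {pG}.
  have [p0|] := hK.1 p hp; first by rewrite p0 in p_pr.
  by rewrite prime_coprime // pG.
have ez : exists z : K, primitive_root_of_unity (exponent GG) z.
  have [s sE] := hK.2; apply: exists_prim_root sE.
  by move: K'G; rewrite -pnat_exponent pcharf'_nat.
have splitG := sufficient_roots_splitting K'G ez.
have [f] := prime_field_rmorphism hq; set F := prime_field q in f.
have corankE n (act : 'I_n -> G -> 'I_n) :
    corank (perm_action_mx F act) J = corank (perm_action_mx K act) J.
  rewrite -(map_corank f); apply: eq_corank => x; exact: map_perm_action_mx.
pose i1 : 'I_#|GG| := gring_index GG 1%g.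
(* The kernel is the stabilizer of 1 in the regular action of G on gT. *)
have transK y : exists g, regular_act lambda i1 g = y.
  have [g gy] := lambda_surj (enum_val y); exists g.
  by rewrite /regular_act gring_indexK ?inE // mul1g gy gring_valK.
have stabK g : regular_act lambda i1 g = i1 <->
    exists h : kernel lambda, kernel_val h = g.
  rewrite /regular_act gring_indexK ?inE // mul1g; split=> [E|[[h kh] <-]].
    suff kg : in_kernel lambda g by exists (Kernel kg).
    apply/eqP; have := congr1 enum_val E.
    by rewrite !gring_indexK ?inE.
  by congr gring_index; apply/eqP.
have valKM : {morph (@kernel_val _ _ lambda) : x y / (x * y)%g} by [].
have [bK [HK bKE]] := stab_H1_dim F hG (regular_act1 lambda)
  (regular_actM lambda) transK valKM val_inj stabK.
(* G is the stabilizer of a point in its trivial action. *)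
have [bG [HG bGE]] : exists b, H1_dim F G b /\
    (b + 1)%N = (corank (perm_action_mx F (fun (i : 'I_1) (_ : G) => i)) J + 1)%N.
  apply: (@stab_H1_dim F _ _ _ _ _ hG 1%N (fun i _ => i) _ _ ord0 _ G id) => //.
    by move=> y; exists 1%g; rewrite !ord1.
  by move=> g; split=> // _; exists g.
exists bK, bG; split=> //.
pose c (i : irrK) := corank (fun x => irr_repr i (lambda x)) J.
have c1 : c [1 irrK]%irr = bG.
  rewrite /c (corank_trivial J (degree_irr1 irrK)); last first.
    by move=> x; apply: irr1_repr; rewrite ?inE.
  by rewrite -corankE; apply/esym/(addIn bGE).
have regE : (bK + #|GG| = \sum_i irr_degree i * c i + 1)%N.
  rewrite bKE corankE (eq_corank _ (perm_action_mx_regular lambda K)).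
  by rewrite (corank_regular irrK K'G splitG).
have degE : #|GG| = (\sum_(i : irrK) irr_degree i ^ 2)%N.
  by rewrite sum_irr_degree_pchar.
rewrite (bigD1 [1 irrK]%irr) //= in regE; rewrite (bigD1 [1 irrK]%irr) //= in degE.
rewrite degE c1 degree_irr1 mul1n exp1n in regE.
transitivity (bG%:Z + ((\sum_(i : irrK | i != [1 irrK]%irr) irr_degree i * c i)%N%:Z
   - (\sum_(i : irrK | i != [1 irrK]%irr) irr_degree i ^ 2)%N%:Z)).
  apply/eqP; rewrite addrA eq_sym subr_eq -!PoszD eqz_nat; apply/eqP.
  by apply: (@addIn 1%N); rewrite -regE addnAC addnA.
congr (_ + _); rewrite !(big_morph Posz PoszD (erefl _)) -sumrB.
apply: eq_bigr => i _; rewrite -/(c i) mulrBr PoszM; congr (_ - _).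
Qed.
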